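(* Fix $n\ge2$. Let $\Omega\subset\partial_\infty\mathbb H^n\times\mathbb R$ be a bounded $C^2$ domain with boundary $\Gamma=\partial\Omega$, and assume that $\Omega$ is convex. Let $\varphi\in C^2(\overline\Omega)$ be a positive function, let $\epsilon\in[0,1]$, and let $g\in C^2(\Omega)\cap C^1(\overline\Omega)$ be a positive solution of the $\epsilon$-horizontal minimal equation $\mathcal M_\epsilon(g)=0$ in $\Omega$ such that $g=\varphi$ on $\Gamma$. Then $$\max_\Gamma|Dg|\le C,$$ where $C$ is a constant depending only on $\min_\Gamma g$, $\max_\Gamma g$, $r(\Omega)$, $\max_\Omega\varphi$, $\max_\Omega|D\varphi|$ and $\max_\Omega|D^2\varphi|$ (in particular, $C$ does not depend on $\epsilon$).
   Context: Upper half-space model: $\mathbb H^n=\{(x_1,\dots,x_{n-1},y): y>0\}$, and $\partial_\infty\mathbb H^n\times\mathbb R$ is identified with $\mathbb R^{n-1}\times\mathbb R=\mathbb R^n$ with coordinates $(x_1,\dots,x_{n-1},t)$ and the Euclidean metric. For a positive $C^2$ function $g=g(x_1,\dots,x_{n-1},t)$ and $\epsilon\in[0,1]$ set $$\mathcal M_\epsilon(g)=\sum_{k=1}^{n-1}\Big[g^2\Big(1+\sum_{j\ne k,\,1\le j\le n-1}g_{x_j}^2\Big)+g_t^2+\tfrac{\epsilon}{n-1}\Big]g_{x_kx_k}+\Big(1+\sum_{k=1}^{n-1}g_{x_k}^2\Big)g_{tt}-2\sum_{k=1}^{n-1}g_{x_k}g_tg_{x_kt}-2g^2\sum_{1\le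 j<k\le n-1}g_{x_j}g_{x_k}g_{x_jx_k}+(n-1)g\Big(1+\sum_{k=1}^{n-1}g_{x_k}^2\Big)+(n-2)\frac{g_t^2}{g}.$$ The equation $\mathcal M_\epsilon(g)=0$ is the $\epsilon$-horizontal minimal equation. A $C^0$ domain $\Omega$ is convex if for every $p\in\partial\Omega$ there is an affine $(n-1)$-plane $\Pi$ of $\partial_\infty\mathbb H^n\times\mathbb R=\mathbb R^n$ with $p\in\Pi\cap\partial\Omega$, $\Pi\cap\Omega=\emptyset$ and $\Omega$ lying on one side of $\Pi$. Definition of $r(\Omega)$: if $n\ge3$, let $\Omega^\pi$ be the orthogonal projection of $\Omega$ on the hyperplane $t=0$ (i.e. on $\mathbb R^{n-1}$); $r(\Omega)$ is the radius of the smallest closed round $(n-1)$-disk containing $\Omega^\pi$ with center in $\Omega^\pi$. If $n=2$ (coordinates $(x,t)$), $r(\Omega)=\tfrac12\big(\max_\Gamma x-\min_\Gamma x\big)$. *)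

(* Defs.v *)
From HB Require Import structures.
From mathcomp Require Import all_boot all_order all_algebra.
From mathcomp Require Import all_classical all_reals all_analysis.

Set Implicit Arguments.
Unset Strict Implicit.
Unset Printing Implicit Defensive.

Import Order.TTheory GRing.Theory Num.Theory.
Import numFieldNormedType.Exports.

Local Open Scope classical_set_scope.
Local Open Scope ring_scope.

Section euclidean.
Context {R : realType}.

Definition dotp m (u v : 'rV[R]_m) : R := \sum_i u 0 i * v 0 i.

(* The norm that the library puts on ['rV[R]_m] is the sup norm; lengths and
   round disks below use the Euclidean norm. *)
Definition enorm m (u : 'rV[R]_m) : R := Num.sqrt (dotp u u).

Definition cdisk m (c : 'rV[R]_m) (rho : R) : set 'rV[R]_m :=
  [set x | enorm (x - c) <= rho].

Definition hyperplane m (a : 'rV[R]_m) (b : R) : set 'rV[R]_m :=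
  [set x | dotp a x = b].

End euclidean.

Section smoothness.
Context {R : realType} {d : nat}.
Implicit Types (U A : set 'rV[R]_d.+1) (f h : 'rV[R]_d.+1 -> R).

Definition bdry A : set 'rV[R]_d.+1 := closure A `\` interior A.

Definition partial (i : 'I_d.+1) f : 'rV[R]_d.+1 -> R :=
  fun x => 'D_(delta_mx 0 i) f x.

(* f is of class C^k in the open set U. *)
Fixpoint Ck (k : nat) U f : Prop :=
  (forall x, U x -> {for x, continuous f}) /\
  (if k is k'.+1 then
     forall i, (forall x, U x -> derivable f x (delta_mx 0 i)) /\
               Ck k' U (partial i f)
   else True).

Definition has_cont_ext U h : Prop :=
  exists H : 'rV[R]_d.+1 -> R,
    {within closure U, continuous H} /\ (forall x, U x -> H x = h x).

Fixpoint der_ext (k : nat) U f : Prop :=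
  has_cont_ext U f /\
  (if k is k'.+1 then forall i, der_ext k' U (partial i f) else True).

(* f belongs to C^k(closure U): it is C^k in the open set U, continuous on
   closure U, and all its partial derivatives of order <= k extend continuously
   from U to closure U.  The values of f outside closure U are irrelevant. *)
Definition Ck_closure (k : nat) U f : Prop :=
  [/\ Ck k U f, {within closure U, continuous f} & der_ext k U f].

(* The value at p of the continuous extension of h from U to closure U. *)
Definition bdval U h (p : 'rV[R]_d.+1) : R := lim (h x @[x --> within U (nbhs p)]).

Definition grad f (x : 'rV[R]_d.+1) : 'rV[R]_d.+1 := \row_i partial i f x.

(* Dg on closure U, for g in C^1(closure U). *)
Definition grad_closure U f (p : 'rV[R]_d.+1) : 'rV[R]_d.+1 :=
  \row_i bdval U (partial i f) p.

Definition hess_norm f (x : 'rV[R]_d.+1) : R :=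
  Num.sqrt (\sum_i \sum_j partial j (partial i f) x ^+ 2).

Definition domain U : Prop := [/\ open U, connected U & U !=set0].

(* C^2 domain: near each boundary point, a C^2 diffeomorphism psi (with C^2
   inverse chi) straightens the boundary, U lying on the side where the last
   coordinate of psi is positive. *)
Definition C2_domain U : Prop :=
  domain U /\
  forall p, bdry U p ->
  exists (V W : set 'rV[R]_d.+1) (psi chi : 'rV[R]_d.+1 -> 'rV[R]_d.+1),
    [/\ [/\ open V, open W & V p],
        [/\ (forall x, V x -> W (psi x) /\ chi (psi x) = x) &
            (forall y, W y -> V (chi y) /\ psi (chi y) = y)],
        (forall i, Ck 2 V (fun x => psi x 0 i)),
        (forall i, Ck 2 W (fun y => chi y 0 i)) &
        forall x, V x -> (U x <-> 0 < psi x 0 ord_max) /\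
                         (bdry U x <-> psi x 0 ord_max = 0)].

(* Convexity through supporting hyperplanes at all boundary points. *)
Definition convex_domain U : Prop :=
  forall p, bdry U p ->
  exists (a : 'rV[R]_d.+1) (b : R),
    [/\ a != 0, (hyperplane a b `&` bdry U) p,
        hyperplane a b `&` U = set0 &
        (forall x, U x -> dotp a x <= b) \/ (forall x, U x -> b <= dotp a x)].

End smoothness.

Section horizontal_minimal_equation.
Context {R : realType} {n : nat}.

(* For n >= 1, ['rV[R]_n.-1.+1] is R^n = R^(n-1) x R; the coordinates
   x_1, ..., x_(n-1) come first and t is the last one. *)
Definition xi (k : 'I_n.-1) : 'I_n.-1.+1 := lift ord_max k.
Definition ti : 'I_n.-1.+1 := ord_max.

Definition M_op (eps : R) (g : 'rV[R]_n.-1.+1 -> R) (p : 'rV[R]_n.-1.+1) : R :=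
  let u := g p in
  let gx k := partial (xi k) g p in
  let gt := partial ti g p in
  let gxx j k := partial (xi k) (partial (xi j) g) p in
  let gxt k := partial ti (partial (xi k) g) p in
  let gtt := partial ti (partial ti g) p in
  \sum_(k < n.-1)
     (u ^+ 2 * (1 + \sum_(j < n.-1 | j != k) gx j ^+ 2) + gt ^+ 2
      + eps / (n.-1)%:R) * gxx k k
  + (1 + \sum_(k < n.-1) gx k ^+ 2) * gtt
  - 2 * (\sum_(k < n.-1) gx k * gt * gxt k)
  - 2 * u ^+ 2 * (\sum_(k < n.-1) \sum_(j < n.-1 | (j < k)%N)
                     gx j * gx k * gxx j k)
  + (n.-1)%:R * u * (1 + \sum_(k < n.-1) gx k ^+ 2)
  + (n - 2)%:R * (gt ^+ 2 / u).

Definition xproj (p : 'rV[R]_n.-1.+1) : 'rV[R]_n.-1 := \row_k p 0 (xi k).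

(* When n = 2, [ord0] is the index of the only horizontal coordinate x.  For
   n >= 3, the smallest radius is written as an infimum over the admissible
   disks. *)
Definition r_dom (Omega : set 'rV[R]_n.-1.+1) : R :=
  let x (p : 'rV[R]_n.-1.+1) := p 0 ord0 in
  if n == 2%N then (sup (x @` bdry Omega) - inf (x @` bdry Omega)) / 2
  else inf [set rho : R | exists2 c, (xproj @` Omega) c &
                            xproj @` Omega `<=` cdisk c rho].

End horizontal_minimal_equation.

(* Main.v *)
(** The minimum principle gives [g >= min_Γ g =: m0], and since
    [g^2 + 2 |x - c|^2] is a strict subsolution, [g <= M := max_Γ g + 2 (r + 1)].
    At a boundary point [p] with inner unit normal [a] to a supporting
    hyperplane, put [l x = a . (x - p)] and compare [g - phi] and [phi - g]
    with [ln (1 + K l) / k].  At an interior maximum of the difference the Hessian of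
    the barrier contributes [- k psi'^2] times the principal part evaluated on
    [a a^T]; that principal part is a sum of squares and is at least
    [min (m0^2, 1)], whereas all the other terms are [O (psi'^2)] once
    [psi' >= 1].  For [k] large this is impossible, uniformly in [eps], so
    [|g - phi| <= E l] in [Omega].  Differentiating at [p] in the directions entering [Omega],
    which form a half-space because the boundary is of class [C^1], bounds
    [D (g - phi)] at [p]. *)

Require Import Defs.
From mathcomp Require Import all_boot all_order all_algebra.
From mathcomp Require Import all_classical all_reals all_analysis.
From mathcomp Require Import ring lra.

Import Order.TTheory GRing.Theory Num.Theory.
Import numFieldNormedType.Exports.

Local Open Scope classical_set_scope.
Local Open Scope ring_scope.

Set Implicit Arguments.
Unset Strict Implicit.
Unset Printing Implicit Defensive.

(** A logarithmic barrier suffices for two reasons. The coefficients and the lower-order terms of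
    the equation are at most quadratic in [Dg], and the barrier solves [psi'' = - k psi'^2]; gain
    and errors are both of order [psi'^2], and the factor [k] decides. Moreover the coefficient form
    is bounded below independently of [Dg] and of [eps], so the normal [a] may point in any
    direction. The comparison runs over all of [Omega], not over a strip along the boundary: with
    [K = k exp (k (M + F))], wherever the barrier has slope below 1 it already exceeds [M + F],
    hence [|g - phi|], so a positive maximum can only occur where the slope is at least 1. The slope
    at 0, [K / k], is the constant [E]. The obstacle at the end is that [g] has derivatives on the
    boundary only as continuous extensions, while its values outside the closure are arbitrary.
    Nothing can be differentiated at [p] itself, and the bound on [Dg] is read off from increments
    of [g - phi] along segments inside [Omega]. *)

(** * Directional derivatives and the mean value theorem along lines *)

Lemma is_derive_epsP (R : realType) (V : normedModType R) (f : V -> R) (x v : V) (df : R) :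
  is_derive x v f df <->
  (forall e : R, 0 < e -> exists2 d : R, 0 < d &
     forall t : R, `|t| < d -> `|f (x + t *: v) - f x - t * df| <= e * `|t|).
Proof.
have key : (fun h => h^-1 *: (f (h *: v + x) - f x)) @ 0^' --> df <->
  (forall e : R, 0 < e -> exists2 d : R, 0 < d &
     forall t : R, `|t| < d -> `|f (x + t *: v) - f x - t * df| <= e * `|t|).
  have quot (t : R) : t != 0 ->
      df - t^-1 *: (f (t *: v + x) - f x) = - t^-1 * (f (x + t *: v) - f x - t * df).
    move=> t0; rewrite [t *: v + x]addrC /GRing.scale /=; field; exact: t0.
  split=> [/cvgrPdist_le H e e0|H].
    have := H _ e0; rewrite /dnbhs near_withinE => /nbhs_ballP[d /= d0 Hd].
    exists d => // t td; have [->|t0] := eqVneq t 0.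
      by rewrite scale0r addr0 subrr mul0r subrr !normr0 mulr0.
    have := Hd t; rewrite /ball /= sub0r normrN => /(_ td t0).
    rewrite quot // normrM normrN normfV => h.
    by rewrite -ler_pdivrMr ?normr_gt0// mulrC.
  apply/cvgrPdist_le => e e0; have [d d0 Hd] := H _ e0.
  rewrite /dnbhs near_withinE; apply/nbhs_ballP; exists d => // t /=.
  rewrite /ball /= sub0r normrN => td t0.
  by rewrite quot // normrM normrN normfV mulrC ler_pdivrMr ?normr_gt0// Hd.
split=> [[df1 df2]|H].
  by apply/key; rewrite -df2; exact: df1.
move/key: H => H; split; first by apply/cvg_ex; exists df.
exact: (cvg_lim _ H).
Qed.

Lemma is_derive_line (R : realType) (V : normedModType R) (f : V -> R) (x v : V) (t df : R) :
  is_derive (x + t *: v) v f df -> is_derive t 1 (fun s => f (x + s *: v)) df.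
Proof.
move=> /is_derive_epsP H; apply/is_derive_epsP => e /H[d d0 Hd].
exists d => // s /Hd; rewrite -[s *: 1]/(s * 1) mulr1.
by rewrite scalerDl addrA.
Qed.

Lemma is_derive_continuous (R : realType) (f : R -> R) (t df : R) :
  is_derive t 1 f df -> {for t, continuous f}.
Proof. by move=> [H _]; exact/differentiable_continuous/derivable1_diffP. Qed.

Lemma MVT_line (R : realType) (V : normedModType R) (f : V -> R) (x v : V) (df : R -> R) :
  (forall t, 0 < t < 1 -> is_derive (x + t *: v) v f (df t)) ->
  {within `[0, 1], continuous (fun t : R => f (x + t *: v))} ->
  exists2 c, 0 < c < 1 & f (x + v) - f x = df c.
Proof.
move=> Hd Hc.
have [|c] := @MVT R (fun t => f (x + t *: v)) df 0 1 ltr01 _ Hc.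
  by move=> t; rewrite in_itv /= => t01; apply: is_derive_line; exact: Hd.
rewrite in_itv /= => c01; rewrite scale1r scale0r addr0 subr0 mulr1 => E.
by exists c.
Qed.

Lemma MVT_line_is_derive (R : realType) (V : normedModType R) (f : V -> R) (x v : V) (df : R -> R) :
  (forall t, 0 <= t <= 1 -> is_derive (x + t *: v) v f (df t)) ->
  exists2 c, 0 < c < 1 & f (x + v) - f x = df c.
Proof.
move=> Hd; apply: MVT_line => [t /andP[t0 t1]|]; first by apply: Hd; rewrite !ltW.
apply: derivable_within_continuous => t; rewrite in_itv /= => t01.
by have /is_derive_line[] := Hd _ t01.
Qed.

Lemma is_derive_scale (R : realType) (V : normedModType R) (f : V -> R) (x v : V) (a df : R) :
  is_derive x v f df -> is_derive x (a *: v) f (a * df).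
Proof.
move=> /is_derive_epsP H; apply/is_derive_epsP => e e0.
have a1 : 0 < 1 + `|a| by rewrite ltr_pwDl.
(* Dividing by [1 + |a|] rather than by [|a|] covers [a = 0]; the same device recurs below. *)
have [d d0 Hd] := H (e / (1 + `|a|)) ltac:(by rewrite divr_gt0).
exists (d / (1 + `|a|)); first by rewrite divr_gt0.
move=> t; rewrite ltr_pdivlMr// => td.
have /Hd : `|t * a| < d.
  by apply: le_lt_trans td; rewrite normrM ler_wpM2l// ler_wpDl.
rewrite scalerA mulrA => /le_trans; apply.
rewrite normrM -mulrA ler_wpM2l ?(ltW e0)// mulrCA.
rewrite ler_piMr// mulrC.
by rewrite ler_pdivrMr// mul1r ler_wpDl.
Qed.

(** * Coordinates, scalar products and [C^1] functions *)

Lemma rV_entry_le (R : realType) d (u : 'rV[R]_d) i : `|u 0 i| <= `|u|.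
Proof.
by rewrite [leRHS]/Num.norm /= mx_normrE; apply/bigmax_geP; right => /=; exists (0, i).
Qed.

Lemma rV_norm_le (R : realType) d (u : 'rV[R]_d) (e : R) :
  0 <= e -> (forall i, `|u 0 i| <= e) -> `|u| <= e.
Proof.
move=> e0 H; rewrite [leLHS]/Num.norm /= mx_normrE; apply: bigmax_le => // -[j i] _.
by rewrite ord1.
Qed.

Lemma Ck_is_derive (R : realType) d k U (f : 'rV[R]_d.+1 -> R) x i :
  Ck k.+1 U f -> U x -> is_derive x (delta_mx 0 i) f (partial i f x).
Proof. by move=> [_ /(_ i)[H _]] /H /derivableP. Qed.

Lemma Ck_continuous (R : realType) d k U (f : 'rV[R]_d.+1 -> R) x :
  Ck k U f -> U x -> {for x, continuous f}.
Proof. by case: k => [|k] [H _] /H. Qed.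

Lemma Ck_partial (R : realType) d k U (f : 'rV[R]_d.+1 -> R) i :
  Ck k.+1 U f -> Ck k U (partial i f).
Proof. by move=> [_ /(_ i)[]]. Qed.

Lemma dotpZr (R : realType) d (u v : 'rV[R]_d) (a : R) : dotp u (a *: v) = a * dotp u v.
Proof. by rewrite /dotp big_distrr; apply: eq_bigr => i _; rewrite /= mxE mulrCA. Qed.

Lemma dotpDr (R : realType) d (u v w : 'rV[R]_d) : dotp u (v + w) = dotp u v + dotp u w.
Proof. by rewrite /dotp -big_split; apply: eq_bigr => i _; rewrite /= mxE mulrDr. Qed.

Lemma dotpDl (R : realType) d (u v w : 'rV[R]_d) : dotp (u + v) w = dotp u w + dotp v w.
Proof. by rewrite /dotp -big_split; apply: eq_bigr => i _; rewrite /= mxE mulrDl. Qed.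

Lemma dotpZl (R : realType) d (u v : 'rV[R]_d) (a : R) : dotp (a *: u) v = a * dotp u v.
Proof. by rewrite /dotp big_distrr; apply: eq_bigr => i _; rewrite /= mxE mulrA. Qed.

Lemma dotpBr (R : realType) d (u v w : 'rV[R]_d) : dotp u (v - w) = dotp u v - dotp u w.
Proof. by rewrite dotpDr -scaleN1r dotpZr mulN1r. Qed.

Lemma dotpBl (R : realType) d (u v w : 'rV[R]_d) : dotp (u - v) w = dotp u w - dotp v w.
Proof. by rewrite dotpDl -scaleN1r dotpZl mulN1r. Qed.

Lemma dotp_delta (R : realType) d (u : 'rV[R]_d) i : dotp u (delta_mx 0 i) = u 0 i.
Proof.
rewrite /dotp (bigD1 i)//= mxE !eqxx mulr1 big1 ?addr0// => j ji.
by rewrite mxE eqxx (negPf ji) mulr0.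
Qed.

Lemma near_all (T : finType) (R : realType) (V : normedModType R) (x : V) (P : T -> V -> Prop) :
  (forall i, \forall y \near x, P i y) ->
  exists2 d : R, 0 < d & forall y, `|y - x| < d -> forall i, P i y.
Proof.
move=> H; have /nbhs_ballP[d /= d0 Hd] : \forall y \near x, forall i, P i y.
  exact: filter_forall.
by exists d => // y yx; apply: Hd; rewrite -ball_normE /= distrC.
Qed.

(* The increment is split into steps parallel to the axes; they stay in the
   sup-norm ball, where the partial derivatives are close to those at x. *)
Lemma C1_strict (R : realType) d (U : set 'rV[R]_d.+1) (f : 'rV[R]_d.+1 -> R) x e :
  open U -> Ck 1 U f -> U x -> 0 < e ->
  exists2 r, 0 < r & forall y h, `|y - x| < r -> `|y + h - x| < r ->
    `|f (y + h) - f y - dotp (grad f x) h| <= e * `|h|.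
Proof.
move=> oU fC Ux e0.
have d0 : 0 < d.+1%:R :> R by [].
have e1 : 0 < e / d.+1%:R by rewrite divr_gt0.
have [r r0 Hr] : exists2 r : R, 0 < r & forall y, `|y - x| < r -> forall i,
    U y /\ `|partial i f x - partial i f y| <= e / d.+1%:R.
  apply: near_all => i; near=> y; split; first by near: y; exact: oU.
  near: y; have /cvgrPdist_le := Ck_continuous (Ck_partial i fC) Ux.
  exact.
exists r => // y h yr yhr.
pose z (k : nat) : 'rV[R]_d.+1 := \row_i (y 0 i + (if (i < k)%N then h 0 i else 0)).
have z0 : z 0%N = y by apply/rowP => i; rewrite mxE addr0.
have zd : z d.+1 = y + h by apply/rowP => i; rewrite !mxE ltn_ord.
have zS (i : 'I_d.+1) : z i.+1 = z i + h 0 i *: delta_mx 0 i.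
  apply/rowP => j; rewrite !mxE ltnS leq_eqVlt eqxx /= -addrA.
  have [->|ji] := eqVneq j i; first by rewrite eqxx ltnn add0r mulr1.
  by rewrite (_ : (j == i :> nat) = false) ?mulr0 ?addr0//; apply/negbTE.
have zr (i : 'I_d.+1) t : 0 <= t <= 1 -> `|z i + t *: (h 0 i *: delta_mx 0 i) - x| < r.
  move=> /andP[t0 t1]; set s := Num.max `|y - x| `|y + h - x|.
  apply: (@le_lt_trans _ _ s); last by rewrite gt_max yr.
  have s0 : 0 <= s by rewrite le_max normr_ge0.
  apply: rV_norm_le => // j.
  have A1 : `|y 0 j - x 0 j| <= s.
    by rewrite le_max; have := rV_entry_le (y - x) j; rewrite !mxE => ->.
  have A2 : `|y 0 j + h 0 j - x 0 j| <= s.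
    by rewrite le_max; have := rV_entry_le (y + h - x) j; rewrite !mxE => ->; rewrite orbT.
  rewrite !mxE eqxx /=; move: A1 A2; rewrite !ler_norml => /andP[A1 A2] /andP[A3 A4].
  have [eji|ji] := eqVneq j i.
    rewrite eji in A1 A2 A3 A4 *; rewrite ltnn mulr1 addr0; apply/andP; split; nra.
  by rewrite !mulr0 addr0; case: ifP => _; apply/andP; split; lra.
have -> : f (y + h) - f y = \sum_(i < d.+1) (f (z i.+1) - f (z i)).
  by rewrite -zd -{1}z0 -(telescope_sumr (f \o z))// big_mkord.
rewrite /dotp -sumrB; apply: le_trans (ler_norm_sum _ _ _) _.
apply: (@le_trans _ _ (\sum_(i < d.+1) (e / d.+1%:R * `|h|))); last first.
  by rewrite sumr_const card_ord -[_ *+ _]mulr_natl mulrA mulrCA divff ?mulr1// gt_eqF.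
apply: ler_sum => i _.
rewrite zS.
have [|c c01 ->] := @MVT_line_is_derive R _ f (z i) (h 0 i *: delta_mx 0 i)
    (fun t => h 0 i * partial i f (z i + t *: (h 0 i *: delta_mx 0 i))).
  move=> t t01; apply: is_derive_scale; apply: Ck_is_derive fC _.
  by have [] := Hr _ (zr i t t01) i.
rewrite mxE [_ * h 0 i]mulrC -mulrBr normrM mulrC ler_pM//; last exact: rV_entry_le.
rewrite distrC; apply: (Hr _ (zr i c _) i).2.
by case/andP: c01 => ? ?; rewrite !ltW.
Unshelve. all: by end_near.
Qed.

(** [Ck] speaks only of derivatives along the coordinate axes; continuity of the partial
    derivatives, through [C1_strict] with base point [x], gives all directions. *)
Lemma C1_is_derive (R : realType) d (U : set 'rV[R]_d.+1) (f : 'rV[R]_d.+1 -> R) x v :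
  open U -> Ck 1 U f -> U x -> is_derive x v f (dotp (grad f x) v).
Proof.
move=> oU fC Ux; apply/is_derive_epsP => e e0.
have v1 : 0 < 1 + `|v| by rewrite ltr_pwDl.
have [r r0 Hr] := C1_strict oU fC Ux (divr_gt0 e0 v1).
exists (r / (1 + `|v|)); first by rewrite divr_gt0.
move=> t; rewrite ltr_pdivlMr// => tr.
have tv : `|t *: v| < r.
  by apply: le_lt_trans tr; rewrite normrZ ler_wpM2l// ler_wpDl.
have := Hr x (t *: v); rewrite subrr normr0 addrC addKr => /(_ r0 tv).
rewrite dotpZr => /le_trans; apply.
rewrite normrZ -mulrA ler_wpM2l ?(ltW e0)// mulrCA ler_piMr// mulrC.
by rewrite ler_pdivrMr// mul1r ler_wpDl.
Qed.

Lemma open_line (R : realType) (V : normedModType R) (U : set V) x v :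
  open U -> U x -> exists2 r : R, 0 < r & forall t, `|t| < r -> U (x + t *: v).
Proof.
move=> oU Ux; have /nbhs_ballP[d /= d0 Hd] := open_nbhs_nbhs (conj oU Ux).
have v1 : 0 < 1 + `|v| by rewrite ltr_pwDl.
exists (d / (1 + `|v|)); first by rewrite divr_gt0.
move=> t; rewrite ltr_pdivlMr// => tr; apply: Hd.
rewrite -ball_normE /= opprD addNKr normrN normrZ.
by apply: le_lt_trans tr; rewrite ler_wpM2l// ler_wpDl.
Qed.

(** * Second derivatives: symmetry and expansions along lines *)

Lemma ler_eps_eq0 (R : realType) (x c : R) :
  (forall e : R, 0 < e -> `|x| <= c * e) -> x = 0.
Proof.
move=> H; apply/normr0_eq0/eqP; rewrite eq_le normr_ge0 andbT leNgt; apply/negP => x0.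
have c1 : 0 < `|c| + 1 by rewrite ltr_wpDl.
have := H (`|x| / 2 / (`|c| + 1)) ltac:(by rewrite !divr_gt0).
apply/negP; rewrite -ltNge mulrA ltr_pdivrMr//.
have := ler_norm c; have := normr_ge0 c; move: (`|c|) (`|x|) x0 => C X; nra.
Qed.

(** The mean value theorem in direction [i], applied to the increment of [f] in direction [j],
    leaves an increment of [partial i f], which [C1_strict] estimates. *)
Lemma Ck2_second_difference (R : realType) d (U : set 'rV[R]_d.+1) (f : 'rV[R]_d.+1 -> R)
    x (i j : 'I_d.+1) (e : R) :
  open U -> Ck 2 U f -> U x -> 0 < e ->
  exists2 r : R, 0 < r & forall s : R, 0 < s < r ->
    `|f (x + s *: delta_mx 0 i + s *: delta_mx 0 j) - f (x + s *: delta_mx 0 i)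
      - (f (x + s *: delta_mx 0 j) - f x)
      - s ^+ 2 * partial j (partial i f) x| <= e * s ^+ 2.
Proof.
move=> oU fC Ux e0.
have [r r0 Hr] := C1_strict oU (Ck_partial i fC) Ux e0.
have /nbhs_ballP[q /= q0 Hq] := open_nbhs_nbhs (conj oU Ux).
have delta1 (k : 'I_d.+1) : `|delta_mx 0 k : 'rV[R]_d.+1| <= 1.
  by apply: rV_norm_le => // l; rewrite mxE; case: (_ && _); rewrite ?normr1 ?normr0.
have m0 : 0 < Num.min r q / 2 by rewrite divr_gt0// lt_min r0.
exists (Num.min r q / 2) => // s /andP[s0 sr].
have s2 : s + s < Num.min r q by lra.
have near1 t : 0 <= t <= s -> `|t *: (delta_mx 0 i : 'rV[R]_d.+1)| <= s.
  by move=> /andP[t0 ts]; rewrite normrZ ger0_norm//; have := delta1 i; nra.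
have near2 : `|s *: (delta_mx 0 j : 'rV[R]_d.+1)| <= s.
  by rewrite normrZ (gtr0_norm s0); have := delta1 j; nra.
have inU t : 0 <= t <= s -> U (x + t *: delta_mx 0 i) /\
    U (x + t *: delta_mx 0 i + s *: delta_mx 0 j).
  move=> /near1 ts; split; apply: Hq; rewrite -ball_normE /=.
    rewrite opprD addNKr normrN; apply: le_lt_trans ts _.
    by move: s2; rewrite lt_min => /andP[_]; lra.
  rewrite -addrA opprD addNKr normrN; apply: le_lt_trans (ler_normD _ _) _.
  by apply: le_lt_trans (lerD ts near2) _; move: s2; rewrite lt_min => /andP[_].
pose F (y : 'rV[R]_d.+1) := f (y + s *: delta_mx 0 j) - f y.
have [|c c01] := @MVT_line_is_derive R _ F x (s *: delta_mx 0 i)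
  (fun t => s * (partial i f (x + (t * s) *: delta_mx 0 i + s *: delta_mx 0 j) -
                 partial i f (x + (t * s) *: delta_mx 0 i))).
  move=> t /andP[t0 t1]; apply: is_derive_scale; rewrite scalerA.
  have [U1 U2] := inU (t * s) ltac:(apply/andP; split; nra).
  apply: is_deriveB; last exact: Ck_is_derive fC _.
  have /is_derive_epsP H := Ck_is_derive i fC U2.
  apply/is_derive_epsP => e' /H[d' d'0 Hd']; exists d' => // u /Hd'.
  by rewrite [_ + u *: _ + _]addrAC.
rewrite /F => ->.
have cs : 0 <= c * s <= s by move: c01 => /andP[c0 c1]; apply/andP; split; nra.
have := Hr (x + (c * s) *: delta_mx 0 i) (s *: delta_mx 0 j).
rewrite [x + _]addrC addrK -[_ + x + _ - x]addrAC addrK.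
rewrite dotpZr dotp_delta mxE -[partial j (partial i f) x]/(partial j (partial i f) x).
have n1 := near1 _ cs.
have mr : Num.min r q <= r by rewrite ge_min lexx.
move=> /(_ ltac:(lra)) /(_ ltac:(by apply: le_lt_trans (ler_normD _ _) _; lra)).
set D := _ - _ - s * _ => HD.
rewrite (_ : _ - _ = s * D); last by rewrite /D; ring.
rewrite normrM (gtr0_norm s0) expr2 mulrCA ler_wpM2l ?(ltW s0)//.
by apply: le_trans HD _; rewrite ler_wpM2l ?(ltW e0).
Qed.

(** The double difference does not see the order of [i] and [j], so it approximates both mixed
    derivatives. [M_op] contains each mixed derivative in one order only; symmetry lets it be read
    as a quadratic form. *)
Lemma Ck2_schwarz (R : realType) d (U : set 'rV[R]_d.+1) (f : 'rV[R]_d.+1 -> R)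
    x (i j : 'I_d.+1) :
  open U -> Ck 2 U f -> U x ->
  partial j (partial i f) x = partial i (partial j f) x.
Proof.
move=> oU fC Ux; apply/eqP; rewrite -subr_eq0; apply/eqP; apply: (@ler_eps_eq0 _ _ 2) => e e0.
have [r r0 Hr] := Ck2_second_difference i j oU fC Ux e0.
have [q q0 Hq] := Ck2_second_difference j i oU fC Ux e0.
pose s := Num.min r q / 2.
have m0 : 0 < Num.min r q by rewrite lt_min r0.
have s0 : 0 < s by rewrite /s divr_gt0.
have sm : s < Num.min r q by rewrite /s; lra.
move: sm; rewrite lt_min => /andP[sr sq].
have := Hr s ltac:(by rewrite s0); have := Hq s ltac:(by rewrite s0).
rewrite [x + s *: delta_mx 0 j + _]addrAC.
set a := f _; set b := f _; set b' := f _; set b'' := f _.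
move: (partial _ _ _) (partial _ _ _) => P Q.
rewrite !ler_norml => /andP[A1 A2] /andP[A3 A4]; have ss : 0 < s ^+ 2 by rewrite exprn_gt0.
by apply/andP; split; rewrite -(ler_pM2r ss); lra.
Qed.

(* Second-order expansion of [f] at [x] along every line through [x]: [l v] and
   [Q v] are the first and second derivatives at 0 of [t |-> f (x + t v)]. *)
Definition jet2 (R : realType) (V : normedModType R) (f : V -> R) (x : V) (l Q : V -> R) :=
  forall (v : V) (e : R), 0 < e -> exists2 r : R, 0 < r & forall t : R, `|t| < r ->
    `|f (x + t *: v) - f x - t * l v - t ^+ 2 / 2 * Q v| <= e * t ^+ 2.

(** The remainder [F] has as derivative the first-order remainder of [df], which differentiability
    of [df] at 0 makes at most [e |c t|] at the mean value point. *)
Lemma taylor2_peano (R : realType) (f df : R -> R) (b r : R) :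
  0 < r -> (forall s : R, `|s| < r -> is_derive s 1 f (df s)) -> is_derive (0 : R) 1 df b ->
  forall e : R, 0 < e -> exists2 q : R, 0 < q & forall t : R, `|t| < q ->
    `|f t - f 0 - t * df 0 - t ^+ 2 / 2 * b| <= e * t ^+ 2.
Proof.
move=> r0 Hf /is_derive_epsP Hdf e e0; have [d d0 Hd] := Hdf e e0.
exists (Num.min r d); first by rewrite lt_min r0.
move=> t; rewrite lt_min => /andP[tr td].
pose F s := f s - s * df 0 - s ^+ 2 / 2 * b.
have [|c /andP[c0 c1]] := @MVT_line_is_derive R R^o F 0 t
    (fun s => t * (df (s * t) - df 0 - s * t * b)).
  move=> s /andP[s0 s1].
  have st : `|s * t| < r.
    by apply: le_lt_trans tr; rewrite normrM ger0_norm// ler_piMl.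
  rewrite -[X in is_derive _ X](_ : t *: (1 : R^o) = _); last exact: mulr1.
  apply: is_derive_scale; rewrite add0r -[s *: _]/(s * t).
  have := Hf _ st => fd; rewrite /F.
  apply: is_derive_eq.
  by rewrite /GRing.scale /=; field.
rewrite add0r {1 2}/F => E.
have -> : f t - f 0 - t * df 0 - t ^+ 2 / 2 * b = t * (df (c * t) - df 0 - c * t * b).
  by rewrite -E expr0n /=; ring.
have ct : `|c * t| <= `|t| by rewrite normrM gtr0_norm// ler_piMl// ltW.
have := Hd (c * t) (le_lt_trans ct td).
rewrite add0r -[_ *: _]/(c * t * 1) mulr1 => H.
rewrite normrM -(real_normK (num_real t)) expr2 mulrCA ler_wpM2l//.
by apply: le_trans H _; rewrite ler_wpM2l// ltW.
Qed.

Lemma is_derive_bigsum (R : realType) (V : normedModType R) (I : Type) (s : seq I) (F : I -> V -> R)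
    (df : I -> R) x v :
  (forall i, is_derive x v (F i) (df i)) ->
  is_derive x v (fun y => \sum_(i <- s) F i y) (\sum_(i <- s) df i).
Proof.
move=> H; elim: s => [|i s IH].
  under [X in is_derive _ _ X]eq_fun do rewrite big_nil.
  by rewrite big_nil; exact: is_derive_cst.
under [X in is_derive _ _ X]eq_fun do rewrite big_cons.
by rewrite big_cons; apply: is_deriveD.
Qed.

Lemma CkS (R : realType) d k (U : set 'rV[R]_d.+1) (f : 'rV[R]_d.+1 -> R) :
  Ck k.+1 U f -> Ck k U f.
Proof.
elim: k f => [|k IH] f [fc fd]; first by split.
by split=> // i; have [fi fCi] := fd i; split=> //; exact: IH.
Qed.

Definition hess_form (R : realType) d (f : 'rV[R]_d.+1 -> R) (x v : 'rV[R]_d.+1) : R :=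
  \sum_i v 0 i * \sum_j v 0 j * partial j (partial i f) x.

Lemma Ck2_jet2 (R : realType) d (U : set 'rV[R]_d.+1) (f : 'rV[R]_d.+1 -> R) x :
  open U -> Ck 2 U f -> U x -> jet2 f x (dotp (grad f x)) (hess_form f x).
Proof.
move=> oU fC Ux v e e0.
have fC1 := CkS fC.
have [r r0 Hr] := open_line v oU Ux.
have [||q q0 Hq] := @taylor2_peano R (fun t => f (x + t *: v))
    (fun t => dotp (grad f (x + t *: v)) v) (hess_form f x v) r r0 _ _ e e0.
- by move=> s /Hr Us; apply: is_derive_line; exact: C1_is_derive oU fC1 Us.
- rewrite /dotp; apply: is_derive_bigsum => i.
  have -> : (fun t => grad f (x + t *: v) 0 i * v 0 i) =
    (fun t => v 0 i *: partial i f (x + t *: v)).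
    by apply/funext => t; rewrite mxE mulrC.
  apply: is_deriveZ; apply: is_derive_line.
  rewrite scale0r addr0 (_ : \sum_j _ = dotp (grad (partial i f) x) v).
    exact: C1_is_derive oU (Ck_partial i fC) Ux.
  by apply: eq_bigr => j _; rewrite mxE mulrC.
by exists q => // t /Hq; rewrite scale0r addr0.
Qed.

Lemma jet2_comp_affine (R : realType) (V W : normedModType R) (f : W -> R) (A L : V -> W) x l Q :
  jet2 f (A x) l Q -> (forall t v, A (x + t *: v) = A x + t *: L v) ->
  jet2 (f \o A) x (l \o L) (Q \o L).
Proof.
move=> H HA v e e0; have [r r0 Hr] := H (L v) e e0.
by exists r => // t /Hr; rewrite /= HA.
Qed.

Lemma jet2_1D (R : realType) (f df : R -> R) (x b r : R) :
  0 < r -> (forall s : R, `|s - x| < r -> is_derive s 1 f (df s)) -> is_derive x 1 df b ->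
  jet2 (f : R^o -> R) x (fun v => df x * v) (fun v => b * v ^+ 2).
Proof.
move=> r0 Hf Hdf v e e0.
have v1 : 0 < 1 + `|v| by rewrite ltr_pwDl.
have v2 : 0 < 1 + v ^+ 2 by rewrite ltr_pwDl// sqr_ge0.
have [||q q0 Hq] := @taylor2_peano R (fun t => f (x + t)) (fun t => df (x + t)) b r r0 _ _ 
   (e / (1 + v ^+ 2)) (divr_gt0 e0 v2).
- move=> s sr; have := Hf (x + s); rewrite addrAC subrr add0r => /(_ sr) H.
  have := @is_derive_line R R^o f x 1 s (df (x + s)); rewrite /GRing.scale /= mulr1 => /(_ H).
  by under eq_fun do rewrite mulr1.
- have := @is_derive_line R R^o df x 1 0 b; rewrite scale0r addr0 => /(_ Hdf).
  by rewrite /GRing.scale /=; under eq_fun do rewrite mulr1.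
exists (q / (1 + `|v|)); first by rewrite divr_gt0.
move=> t; rewrite ltr_pdivlMr// => tq.
have /Hq : `|t * v| < q by apply: le_lt_trans tq; rewrite normrM ler_wpM2l// ler_wpDl.
rewrite addr0 -[t *: v]/(t * v).
rewrite (_ : (t * v) ^+ 2 / 2 * b = t ^+ 2 / 2 * (b * v ^+ 2)); last by ring.
rewrite -mulrA [v * df x]mulrC => /le_trans; apply.
rewrite -mulrA ler_wpM2l ?(ltW e0)// exprMn mulrCA ler_piMr ?sqr_ge0//.
by rewrite mulrC ler_pdivrMr// mul1r ler_wpDl.
Qed.

Lemma jet2D (R : realType) (V : normedModType R) (f g : V -> R) x l1 Q1 l2 Q2 :
  jet2 f x l1 Q1 -> jet2 g x l2 Q2 ->
  jet2 (f \+ g) x (l1 \+ l2) (Q1 \+ Q2).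
Proof.
move=> Hf Hg v e e0.
have e2 : 0 < e / 2 by rewrite divr_gt0.
have [r r0 Hr] := Hf v _ e2; have [q q0 Hq] := Hg v _ e2.
exists (Num.min r q); first by rewrite lt_min r0.
move=> t; rewrite lt_min /= => /andP[/Hr H1 /Hq H2].
move: H1 H2; rewrite !ler_norml => /andP[? ?] /andP[? ?].
by apply/andP; split; lra.
Qed.

Lemma jet2Z (R : realType) (V : normedModType R) (f : V -> R) x l Q (c : R) :
  jet2 f x l Q -> jet2 (fun y => c * f y) x (fun v => c * l v) (fun v => c * Q v).
Proof.
move=> Hf v e e0.
have c1 : 0 < 1 + `|c| by rewrite ltr_pwDl.
have [r r0 Hr] := Hf v _ (divr_gt0 e0 c1).
exists r => // t /Hr H.
rewrite (_ : _ - _ = c * (f (x + t *: v) - f x - t * l v - t ^+ 2 / 2 * Q v)); last by ring.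
rewrite normrM; apply: le_trans (ler_wpM2l (normr_ge0 c) H) _.
rewrite mulrA ler_wpM2r ?sqr_ge0// mulrCA ger_pMr//.
by rewrite ler_pdivrMr// mul1r ler_wpDl.
Qed.

Lemma jet2_max (R : realType) (V : normedModType R) (U : set V) (f : V -> R) x l Q :
  open U -> U x -> (forall y, U y -> f y <= f x) -> jet2 f x l Q ->
  forall v, l v = 0 /\ Q v <= 0.
Proof.
move=> oU Ux Hmax Hf v.
have [q q0 Hq] := open_line v oU Ux.
have bound e : 0 < e -> exists2 r : R, 0 < r & forall t : R, `|t| < r ->
    t * l v + t ^+ 2 / 2 * Q v <= e * t ^+ 2.
  move=> e0; have [r r0 Hr] := Hf v _ e0.
  exists (Num.min r q); first by rewrite lt_min r0.
  move=> t; rewrite lt_min => /andP[/Hr H /Hq /Hmax tq].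
  by move: H; rewrite ler_norml => /andP[H _]; lra.
have l0 : l v = 0.
  apply: (@ler_eps_eq0 _ _ 1) => e e0; rewrite mul1r.
  have [r r0 Hr] := bound 1 ltr01.
  have B0 : 0 < 1 + `|Q v| by rewrite ltr_pwDl.
  (* So small that the second-order contribution [t (1 + |Q v|)] is at most [e]; testing both [t]
     and [- t] bounds [l v] from both sides. *)
  pose t := Num.min (r / 2) (e / (1 + `|Q v|)).
  have t0 : 0 < t by rewrite /t lt_min !divr_gt0.
  have tr : t < r by rewrite /t gt_min; apply/orP; left; lra.
  have te : t * (1 + `|Q v|) <= e by rewrite -ler_pdivlMr// /t ge_min lexx orbT.
  have := Hr t; rewrite (gtr0_norm t0) => /(_ tr) H1.
  have := Hr (- t); rewrite normrN (gtr0_norm t0) => /(_ tr) H2.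
  have := ler_norm (- Q v); rewrite normrN => Q1.
  rewrite -(ler_pM2l t0); have: t * `|l v| <= t ^+ 2 * (1 + `|Q v|).
    rewrite -[in leLHS](gtr0_norm t0) -normrM ler_norml.
    have tQ : 0 <= t ^+ 2 * (`|Q v| + Q v) by rewrite mulr_ge0 ?sqr_ge0//; lra.
    have tQ' : 0 <= t ^+ 2 * `|Q v| by rewrite mulr_ge0 ?sqr_ge0.
    by rewrite sqrrN in H2; apply/andP; split; lra.
  by move=> /le_trans; apply; rewrite expr2 -mulrA ler_wpM2l// ltW.
split=> //; rewrite leNgt; apply/negP => Q0.
have [r r0 Hr] := bound (Q v / 4) ltac:(by rewrite divr_gt0).
have := Hr (r / 2); rewrite gtr0_norm ?divr_gt0// l0 => /(_ ltac:(lra)).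
have : 0 < (r / 2) ^+ 2 by rewrite exprn_gt0// divr_gt0.
nra.
Qed.

Lemma jet2_quadratic (R : realType) (V : normedModType R) (f : V -> R) x (l Q : V -> R) :
  (forall t v, f (x + t *: v) = f x + t * l v + t ^+ 2 / 2 * Q v) -> jet2 f x l Q.
Proof.
move=> H v e e0; exists 1 => // t _; rewrite H.
rewrite (_ : _ - _ = 0); last by ring.
by rewrite normr0 mulr_ge0 ?sqr_ge0 ?ltW.
Qed.

Lemma jet2_sqr (R : realType) (V : normedModType R) (f : V -> R) x (l Q : V -> R) :
  jet2 f x l Q ->
  jet2 (fun y => f y ^+ 2) x (fun v => 2 * f x * l v)
    (fun v => 2 * f x * Q v + 2 * l v ^+ 2).
Proof.
move=> Hf v e e0.
pose e' := Num.min 1 (e / 2 / (1 + 2 * `|f x|)).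
have F1 : 0 < 1 + 2 * `|f x| by rewrite ltr_pwDl// mulr_ge0.
have e'0 : 0 < e' by rewrite lt_min ltr01 !divr_gt0.
have e'1 : e' <= 1 by rewrite ge_min lexx.
have e'e : e' * (1 + 2 * `|f x|) <= e / 2 by rewrite -ler_pdivlMr// ge_min lexx orbT.
have [r r0 Hr] := Hf v _ e'0.
pose B := `|Q v| / 2 + 1.
have B0 : 0 < B by rewrite ltr_wpDl// divr_ge0.
pose K := 1 + B * (2 * `|l v| + B).
have K0 : 0 < K.
  by rewrite ltr_pwDl// mulr_ge0 ?(ltW B0)// addr_ge0 ?(ltW B0)// mulr_ge0.
exists (Num.min r (Num.min 1 (e / 2 / K))).
  by rewrite !lt_min r0 ltr01 !divr_gt0.
move=> t; rewrite !lt_min => /and3P[/Hr H t1]; rewrite ltr_pdivlMr// => tK.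
set D := f (x + t *: v) - f x in H.
(* The second summand is [D^2 - t^2 (l v)^2], factored: [D - t l v] is of order [t^2] and
   [D + t l v] of order [t], so the product is cubic. *)
have -> : f (x + t *: v) ^+ 2 - f x ^+ 2 - t * (2 * f x * l v)
    - t ^+ 2 / 2 * (2 * f x * Q v + 2 * l v ^+ 2) =
    2 * f x * (D - t * l v - t ^+ 2 / 2 * Q v) + (D - t * l v) * (D + t * l v).
  by rewrite /D; field.
have tt : t ^+ 2 = `|t| * `|t| by rewrite -expr2 real_normK// num_real.
have D1 : `|D - t * l v| <= B * t ^+ 2.
  have t2 := sqr_ge0 t.
  have : `|t ^+ 2 / 2 * Q v| = t ^+ 2 / 2 * `|Q v|.
    by rewrite normrM [`|t ^+ 2 / 2|]ger0_norm// divr_ge0.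
  move: H (ler_normD (D - t * l v - t ^+ 2 / 2 * Q v) (t ^+ 2 / 2 * Q v)).
  rewrite subrK => H /le_trans H2 E; apply: H2; rewrite E /B; nra.
have D2 : `|D + t * l v| <= `|t| * (2 * `|l v| + B).
  have -> : D + t * l v = (D - t * l v) + 2 * (t * l v) by ring.
  apply: le_trans (ler_normD _ _) _; rewrite !normrM normr_nat.
  have : B * t ^+ 2 <= B * `|t| by rewrite tt ler_pM2l// ler_piMl// ltW.
  lra.
apply: le_trans (ler_normD _ _) _; rewrite !normrM normr_nat.
have P1 : 2 * `|f x| * `|D - t * l v - t ^+ 2 / 2 * Q v| <= e / 2 * t ^+ 2.
  apply: le_trans (ler_wpM2l _ H) _; first by rewrite mulr_ge0.
  by rewrite mulrA ler_wpM2r ?sqr_ge0//; lra.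
have P2 : `|D - t * l v| * `|D + t * l v| <= e / 2 * t ^+ 2.
  apply: le_trans (ler_pM (normr_ge0 _) (normr_ge0 _) D1 D2) _.
  rewrite mulrAC ler_wpM2r ?sqr_ge0//.
  by move: tK; rewrite /K; have := normr_ge0 t; lra.
lra.
Qed.

(** * The operator as a sum of values of the Hessian form *)

(** [hess_form] with an abstract matrix in place of the second derivatives, so that the identity for
    the principal part is pure algebra. *)
Definition quad_form (R : realType) d (H : 'I_d -> 'I_d -> R) (v : 'rV[R]_d) : R :=
  \sum_i v 0 i * \sum_j v 0 j * H i j.

Lemma sum_delta2 (R : realType) d (F : 'I_d -> R) (a b : R) i j :
  \sum_l (a *: delta_mx 0 i + b *: delta_mx 0 j : 'rV[R]_d) 0 l * F l = a * F i + b * F j.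
Proof.
have E c k : \sum_l (c *: delta_mx 0 k : 'rV[R]_d) 0 l * F l = c * F k.
  rewrite (bigD1 k)//= !mxE !eqxx mulr1 big1 ?addr0// => l lk.
  by rewrite !mxE eqxx (negPf lk) mulr0 mul0r.
by rewrite -!E -big_split; apply: eq_bigr => l _; rewrite mxE mulrDl.
Qed.

Lemma quad_form_delta2 (R : realType) d (H : 'I_d -> 'I_d -> R) (a b : R) i j :
  quad_form H (a *: delta_mx 0 i + b *: delta_mx 0 j) =
  a ^+ 2 * H i i + a * b * (H i j + H j i) + b ^+ 2 * H j j.
Proof. by rewrite /quad_form sum_delta2 !sum_delta2; ring. Qed.

Lemma quad_form_delta (R : realType) d (H : 'I_d -> 'I_d -> R) i :
  quad_form H (delta_mx 0 i) = H i i.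
Proof.
have := quad_form_delta2 H 1 0 i i; rewrite scale0r addr0 scale1r => ->.
by rewrite expr1n expr0n /= !mul0r mulr0 mul0r !addr0 mul1r.
Qed.

(** In [M_op] the squares run over ordered pairs and the mixed terms over [j < k]; grouping by
    unordered pairs is what completes the squares. *)
Lemma sum_neq_ltn (V : nmodType) N (F : 'I_N -> 'I_N -> V) :
  \sum_(k < N) \sum_(j < N | j != k) F j k = \sum_(k < N) \sum_(j < N | (j < k)%N) (F j k + F k j).
Proof.
have -> : \sum_(k < N) \sum_(j < N | (j < k)%N) (F j k + F k j) =
    \sum_(k < N) \sum_(j < N | (j < k)%N) F j k + \sum_(k < N) \sum_(j < N | (k < j)%N) F j k.
  under eq_bigr do rewrite big_split.
  rewrite big_split; congr (_ + _).
  rewrite (exchange_big_dep predT)//=.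
rewrite -big_split; apply: eq_bigr => k _ /=.
rewrite (bigID (fun j : 'I_N => (j < k)%N))/=; congr (_ + _); apply: eq_bigl => j.
  by rewrite -val_eqE /=; case: ltngtP.
by rewrite -val_eqE /=; case: ltngtP.
Qed.

(** Each index lies in [N.-1] unordered pairs. *)
Lemma sum_ltn_add (R : realType) N (a : 'I_N -> R) :
  \sum_(k < N) \sum_(j < N | (j < k)%N) (a j + a k) = N.-1%:R * \sum_(k < N) a k.
Proof.
rewrite -(sum_neq_ltn (fun j k => a j)) (exchange_big_dep predT)//= mulr_sumr.
apply: eq_bigr => j _; rewrite sumr_const mulr_natl; congr (_ *+ _).
rewrite -[N in RHS]card_ord -(cardC1 j); apply: eq_card => k.
by rewrite !inE eq_sym.
Qed.

(* The principal part of [M_op] at a point with value [u] and gradient [q] is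
   the sum of the values of the Hessian form [Q] at the vectors
   [u e_k], [u (q_j e_k - q_k e_j)], [q_t e_k - q_k e_t], [e_t] and
   [sqrt (eps / (n-1)) e_k]. *)
Definition principal (R : realType) n (eps u : R) (q : 'rV[R]_n.-1.+1)
    (Q : 'rV[R]_n.-1.+1 -> R) : R :=
  (u ^+ 2 + eps / n.-1%:R) * (\sum_k Q (delta_mx 0 (xi k)))
  + u ^+ 2 * (\sum_(k < n.-1) \sum_(j < n.-1 | (j < k)%N)
      Q (q 0 (xi j) *: delta_mx 0 (xi k) + (- q 0 (xi k)) *: delta_mx 0 (xi j)))
  + \sum_k Q (q 0 ti *: delta_mx 0 (xi k) + (- q 0 (xi k)) *: delta_mx 0 ti)
  + Q (delta_mx 0 ti).

(** At [q_j e_k - q_k e_j] a symmetric form takes the value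
    [q_j^2 H_kk - 2 q_j q_k H_jk + q_k^2 H_jj]; the outer terms sum to the inner sum over [j != k],
    the middle ones to the mixed terms. The vectors involving [e_t] work in the same way. *)
Lemma principal_quad_form (R : realType) n (eps u : R) (q : 'rV[R]_n.-1.+1)
    (H : 'I_n.-1.+1 -> 'I_n.-1.+1 -> R) :
  (forall i j, H i j = H j i) ->
  principal eps u q (quad_form H) =
  \sum_(k < n.-1)
     (u ^+ 2 * (1 + \sum_(j < n.-1 | j != k) q 0 (xi j) ^+ 2) + q 0 ti ^+ 2
      + eps / (n.-1)%:R) * H (xi k) (xi k)
  + (1 + \sum_(k < n.-1) q 0 (xi k) ^+ 2) * H ti ti
  - 2 * (\sum_(k < n.-1) q 0 (xi k) * q 0 ti * H (xi k) ti)
  - 2 * u ^+ 2 * (\sum_(k < n.-1) \sum_(j < n.-1 | (j < k)%N)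
                     q 0 (xi j) * q 0 (xi k) * H (xi j) (xi k)).
Proof.
move=> HS; rewrite /principal quad_form_delta.
under eq_bigr do rewrite quad_form_delta.
have -> : \sum_(k < n.-1) \sum_(j < n.-1 | (j < k)%N) quad_form H
    (q 0 (xi j) *: delta_mx 0 (xi k) + - q 0 (xi k) *: delta_mx 0 (xi j)) =
  \sum_(k < n.-1) \sum_(j < n.-1 | j != k) q 0 (xi j) ^+ 2 * H (xi k) (xi k) -
  2 * \sum_(k < n.-1) \sum_(j < n.-1 | (j < k)%N)
     q 0 (xi j) * q 0 (xi k) * H (xi j) (xi k).
  rewrite [X in _ = X - _](sum_neq_ltn (fun j k => q 0 (xi j) ^+ 2 * H (xi k) (xi k))).
  rewrite mulr_sumr -sumrB; apply: eq_bigr => k _.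
  rewrite mulr_sumr -sumrB; apply: eq_bigr => j _.
  by rewrite quad_form_delta2 (HS (xi k) (xi j)); ring.
have -> : \sum_(k < n.-1) quad_form H (q 0 ti *: delta_mx 0 (xi k)
      + - q 0 (xi k) *: delta_mx 0 ti) =
  q 0 ti ^+ 2 * (\sum_(k < n.-1) H (xi k) (xi k))
  - 2 * (\sum_(k < n.-1) q 0 (xi k) * q 0 ti * H (xi k) ti)
  + (\sum_(k < n.-1) q 0 (xi k) ^+ 2) * H ti ti.
  rewrite mulr_sumr mulr_sumr mulr_suml -sumrB -big_split; apply: eq_bigr => k _ /=.
  by rewrite quad_form_delta2 (HS ti (xi k)); ring.
have -> : \sum_(k < n.-1)
     (u ^+ 2 * (1 + \sum_(j < n.-1 | j != k) q 0 (xi j) ^+ 2) + q 0 ti ^+ 2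
      + eps / (n.-1)%:R) * H (xi k) (xi k) =
   (u ^+ 2 + eps / n.-1%:R) * (\sum_(k < n.-1) H (xi k) (xi k))
   + u ^+ 2 * (\sum_(k < n.-1) \sum_(j < n.-1 | j != k) q 0 (xi j) ^+ 2 * H (xi k) (xi k))
   + q 0 ti ^+ 2 * (\sum_(k < n.-1) H (xi k) (xi k)).
  rewrite !mulr_sumr -!big_split; apply: eq_bigr => k _ /=.
  by rewrite -mulr_suml; ring.
ring.
Qed.

Lemma M_opE (R : realType) n (U : set 'rV[R]_n.-1.+1) (g : 'rV[R]_n.-1.+1 -> R) (eps : R) x :
  open U -> Ck 2 U g -> U x ->
  M_op eps g x = principal eps (g x) (grad g x) (hess_form g x)
   + n.-1%:R * g x * (1 + \sum_(k < n.-1) grad g x 0 (xi k) ^+ 2)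
   + (n - 2)%:R * (grad g x 0 ti ^+ 2 / g x).
Proof.
move=> oU gC Ux.
have -> : hess_form g x = quad_form (fun i j => partial j (partial i g) x) by [].
rewrite principal_quad_form; last by move=> i j; exact: Ck2_schwarz oU gC Ux.
have E i : partial i g x = grad g x 0 i by rewrite mxE.
rewrite /M_op.
congr (_ + _ * (_ / _)); last by rewrite E.
congr (_ + _ * (1 + _)); last by apply: eq_bigr => k _; rewrite E.
congr (_ - _ * _).
  congr (_ - _ * _).
    congr (_ + (1 + _) * _).
      apply: eq_bigr => k _; congr ((_ * (1 + _) + _ + _) * _).
        by apply: eq_bigr => j _; rewrite E.
      by rewrite E.
    by apply: eq_bigr => k _; rewrite E.
  by apply: eq_bigr => k _; rewrite !E.
by apply: eq_bigr => k _; apply: eq_bigr => j _; rewrite !E.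
Qed.

Lemma xi_neq_ti n (k : 'I_n.-1) : xi k != ti :> 'I_n.-1.+1.
Proof. by rewrite /xi /ti eq_sym neq_lift. Qed.

Lemma xi_inj n : injective (@xi n).
Proof. exact: lift_inj. Qed.

Lemma sum_xi_ti (V : nmodType) n (F : 'I_n.-1.+1 -> V) :
  \sum_i F i = \sum_k F (xi k) + F ti.
Proof. by rewrite (bigD1_ord ti)//= addrC. Qed.

(** Ellipticity: all values of the form enter with non-negative coefficients, so inequalities
    between forms pass to [principal] without any matrix argument. *)
Lemma principal_le (R : realType) n (eps u : R) (q : 'rV[R]_n.-1.+1) Q1 Q2 :
  0 <= eps -> (forall v, Q1 v <= Q2 v) ->
  principal eps u q Q1 <= principal eps u q Q2.
Proof.
move=> e0 H; rewrite /principal.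
have uu := sqr_ge0 u.
by rewrite !lerD// ?ler_wpM2l ?addr_ge0 ?divr_ge0//; do ?apply: ler_sum => ? _.
Qed.

Lemma principalD (R : realType) n (eps u : R) (q : 'rV[R]_n.-1.+1) Q1 Q2 :
  principal eps u q (Q1 \+ Q2) = principal eps u q Q1 + principal eps u q Q2.
Proof.
rewrite /principal /=.
under [X in u ^+ 2 * X]eq_bigr do rewrite big_split.
rewrite !big_split /=; ring.
Qed.

Lemma principalZ (R : realType) n (eps u c : R) (q : 'rV[R]_n.-1.+1) Q :
  principal eps u q (fun v => c * Q v) = c * principal eps u q Q.
Proof.
rewrite /principal.
under [X in u ^+ 2 * X]eq_bigr do rewrite -mulr_sumr.
rewrite -!mulr_sumr; ring.
Qed.

(** For [tau = 1] this is the squared Euclidean norm, whose principal part is the trace of the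
    coefficient matrix; [2 * diag_form 0] is the Hessian of [horiz]. *)
Definition diag_form (R : realType) n (tau : R) (v : 'rV[R]_n.-1.+1) : R :=
  \sum_k v 0 (xi k) ^+ 2 + tau * v 0 ti ^+ 2.

Lemma diag_form_delta2 (R : realType) n (tau a b : R) (i j : 'I_n.-1.+1) :
  i != j -> diag_form tau (a *: delta_mx 0 i + b *: delta_mx 0 j) =
  a ^+ 2 * (if i == ti then tau else 1) + b ^+ 2 * (if j == ti then tau else 1).
Proof.
move=> ij; set v := (_ + _); pose c (i : 'I_n.-1.+1) := if i == ti then tau else 1.
have -> : diag_form tau v = \sum_i v 0 i * (v 0 i * c i).
  rewrite sum_xi_ti /c eqxx /diag_form; congr (_ + _); last by ring.
  by apply: eq_bigr => k _; rewrite (negPf (xi_neq_ti k)) mulr1 expr2.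
rewrite sum_delta2 /v !mxE !eqxx (negPf ij) [j == i]eq_sym (negPf ij) /c /=.
by rewrite !mulr1 !mulr0 addr0 add0r; ring.
Qed.

Lemma diag_form_delta (R : realType) n (tau : R) (i : 'I_n.-1.+1) :
  diag_form tau (delta_mx 0 i) = if i == ti then tau else 1.
Proof.
rewrite /diag_form mxE eqxx /= [ti == i]eq_sym; case: eqP => [->|/eqP it].
  rewrite big1 ?add0r ?expr1n ?mulr1// => k _.
  by rewrite mxE (negPf (xi_neq_ti k)) andbF expr0n.
rewrite expr0n mulr0 addr0 -[RHS](_ : \sum_j (delta_mx 0 i : 'rV[R]__) 0 j ^+ 2 = 1).
  by rewrite sum_xi_ti mxE [ti == i]eq_sym (negPf it) andbF expr0n addr0.
rewrite (bigD1 i)//= mxE !eqxx expr1n big1 ?addr0// => j ji.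
by rewrite mxE (negPf ji) andbF expr0n.
Qed.

Lemma principal_diag (R : realType) n (eps u tau : R) (q : 'rV[R]_n.-1.+1) :
  principal eps u q (diag_form tau) =
  (u ^+ 2 + eps / n.-1%:R) * n.-1%:R + u ^+ 2 * (n.-1.-1%:R * \sum_k q 0 (xi k) ^+ 2)
  + n.-1%:R * q 0 ti ^+ 2 + tau * (\sum_k q 0 (xi k) ^+ 2 + 1).
Proof.
rewrite /principal diag_form_delta eqxx.
under eq_bigr do rewrite diag_form_delta (negPf (xi_neq_ti _)).
have -> : \sum_(k < n.-1) \sum_(j < n.-1 | (j < k)%N) diag_form tau
    (q 0 (xi j) *: delta_mx 0 (xi k) + - q 0 (xi k) *: delta_mx 0 (xi j)) =
    n.-1.-1%:R * \sum_k q 0 (xi k) ^+ 2.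
  rewrite -sum_ltn_add; apply: eq_bigr => k _; apply: eq_bigr => j jk.
  rewrite diag_form_delta2; last by rewrite (inj_eq (@xi_inj n)) -val_eqE /= gtn_eqF.
  by rewrite !(negPf (xi_neq_ti _)) sqrrN !mulr1.
under [X in _ + X + _]eq_bigr do
  rewrite diag_form_delta2 ?xi_neq_ti// (negPf (xi_neq_ti _)) eqxx sqrrN mulr1.
by rewrite big_split /= !sumr_const card_ord -mulr_suml -[1 *+ _]/(n.-1%:R) -[_ ^+ 2 *+ _]mulr_natl; ring.
Qed.

(** Only the squares at [u e_k] and at [e_t] are kept. The resulting bound contains neither [q] nor
    [eps], which is the source of the uniformity in [eps]. *)
Lemma principal_sqr_dotp (R : realType) n (eps u : R) (q a : 'rV[R]_n.-1.+1) :
  0 <= eps ->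
  u ^+ 2 * (\sum_k a 0 (xi k) ^+ 2) + a 0 ti ^+ 2 <=
  principal eps u q (fun v => dotp a v ^+ 2).
Proof.
move=> e0; rewrite /principal.
under [X in (u ^+ 2 + _) * X]eq_bigr do rewrite dotp_delta.
rewrite dotp_delta lerD2r mulrDl -!addrA lerDl.
by do ![exact: sqr_ge0 | apply: addr_ge0 | apply: mulr_ge0 | apply: sumr_ge0 => * |
        rewrite divr_ge0].
Qed.

Lemma dotp_diag (R : realType) n (v : 'rV[R]_n.-1.+1) : dotp v v = diag_form 1 v.
Proof. by rewrite /dotp sum_xi_ti /diag_form mul1r. Qed.

(** * Interior extrema excluded by the equation *)

(** At a minimum the principal part is non-negative, and so is the term in [g_t^2 / g], whereas the
    zero-order term [(n-1) g (1 + |g_x|^2)] is strictly positive because [n >= 2]. *)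
Lemma no_interior_min (R : realType) n (U : set 'rV[R]_n.-1.+1)
    (g : 'rV[R]_n.-1.+1 -> R) (eps : R) x :
  (2 <= n)%N -> open U -> Ck 2 U g -> U x -> 0 <= eps -> 0 < g x -> M_op eps g x = 0 ->
  ~ (forall y, U y -> g x <= g y).
Proof.
move=> n2 oU gC Ux e0 g0; rewrite (M_opE eps oU gC Ux) => Mg gmin.
have Hg : forall v, hess_form g x v >= 0.
  have gmax y : U y -> -1 * g y <= -1 * g x by move=> Uy; rewrite !mulN1r lerN2 gmin.
  move=> v; have [_] := jet2_max oU Ux gmax (jet2Z (-1) (Ck2_jet2 oU gC Ux)) v.
  by rewrite mulN1r oppr_le0.
have P0 : 0 <= principal eps (g x) (grad g x) (hess_form g x).
  (* The zero form is written as a multiple by 0 of some form, so that [principalZ] evaluates its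
     principal part; this is done again in the two maximum arguments below. *)
  have := principalZ eps (g x) 0 (grad g x) (hess_form g x); rewrite mul0r => <-.
  by apply: principal_le => // v; rewrite mul0r.
have N0 : 0 < n.-1%:R :> R by rewrite ltr0n; case: n n2 {U g oU gC x Ux g0 Mg gmin Hg P0} => [|[]].
have L0 : 0 < n.-1%:R * g x * (1 + \sum_(k < n.-1) grad g x 0 (xi k) ^+ 2).
  by rewrite !mulr_gt0// ltr_pwDl// sumr_ge0// => k _; rewrite sqr_ge0.
have L1 : 0 <= (n - 2)%:R * (grad g x 0 ti ^+ 2 / g x).
  by rewrite mulr_ge0// divr_ge0 ?sqr_ge0 ?ltW.
move: (principal _ _ _ _) P0 Mg L0 L1 => P; move: (_ * (1 + _)) (_ * (_ / _)) => A B; lra.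
Qed.

(** Only horizontal coordinates enter, because [r_dom] controls no extent in [t]. *)
Definition horiz (R : realType) n (c y : 'rV[R]_n.-1.+1) : R :=
  \sum_k (y 0 (xi k) - c 0 (xi k)) ^+ 2.

(* The term [2 |x - c|^2] beats the sign of the zero-order term [(n-1) g], so
   [g^2 + 2 |x - c|^2] is a strict subsolution. *)
Lemma no_interior_max (R : realType) n (U : set 'rV[R]_n.-1.+1)
    (g : 'rV[R]_n.-1.+1 -> R) (eps : R) c x :
  (2 <= n)%N -> open U -> Ck 2 U g -> U x -> 0 <= eps -> 0 < g x -> M_op eps g x = 0 ->
  ~ (forall y, U y -> g y ^+ 2 + 2 * horiz c y <= g x ^+ 2 + 2 * horiz c x).
Proof.
move=> n2 oU gC Ux e0 g0; rewrite (M_opE eps oU gC Ux) => Mg gmax.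
have hj : jet2 (@horiz R n c) x (fun v => 2 * \sum_k (x 0 (xi k) - c 0 (xi k)) * v 0 (xi k))
    (fun v => 2 * diag_form 0 v).
  apply: jet2_quadratic => t v; rewrite /horiz /diag_form mul0r addr0.
  rewrite [2 * \sum_k (v 0 _ ^+ 2)]mulr_sumr !mulr_sumr -!big_split.
  by apply: eq_bigr => k _; rewrite /= !mxE; field.
have Hh : forall v, 2 * g x * hess_form g x v + 2 * dotp (grad g x) v ^+ 2
    + 2 * (2 * diag_form 0 v) <= 0.
  by move=> v; have [] := jet2_max oU Ux gmax
    (jet2D (jet2_sqr (Ck2_jet2 oU gC Ux)) (jet2Z 2 hj)) v.
pose P Q := principal eps (g x) (grad g x) Q.
have PH : 2 * g x * P (hess_form g x) + 2 * P (fun v => dotp (grad g x) v ^+ 2)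
    + 2 * (2 * P (diag_form 0)) <= 0.
  rewrite /P -!principalZ -!principalD.
  have Z := principalZ eps (g x) 0 (grad g x) (diag_form 0); rewrite mul0r in Z.
  rewrite -[leRHS]Z; apply: principal_le => // v; rewrite mul0r; exact: Hh.
have P1 := principal_sqr_dotp (g x) (grad g x) (grad g x) e0.
have P2 := principal_diag eps (g x) 0 (grad g x).
rewrite -/(P (hess_form g x)) in Mg; rewrite -/(P _) in P1; rewrite -/(P (diag_form 0)) mul0r addr0 in P2.
move: (P (hess_form g x)) (P (fun v => dotp (grad g x) v ^+ 2)) (P (diag_form 0)) Mg PH P1 P2 => PA PB PC.
move=> {P Hh hj gmax}.
case: n n2 U g c x oU gC Ux g0 => [//|[//|m]] _ U g c x _ _ _ g0 /=.
rewrite !subSS subn0.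
have : 0 <= \sum_(k < m.+1) grad g x 0 (xi (n:=m.+2) k) ^+ 2.
  by apply: sumr_ge0 => k _; rewrite sqr_ge0.
have : 0 <= grad g x 0 (ti (n:=m.+2)) ^+ 2 by rewrite sqr_ge0.
have e1 : eps / m.+1%:R * m.+1%:R = eps by rewrite divfK// pnatr_eq0.
rewrite [(g x ^+ 2 + _) * _]mulrDl e1.
move: (_ ^+ 2) (\sum_(k < _) _) => Z S Z0 S0; move: (g x) g0 => u u0.
rewrite -natr1; have : 0 <= m%:R :> R by []; move: (m%:R) => M M0 Mg PH P1 P2.
have uZ : u * (M * (Z / u)) = M * Z by field; rewrite gt_eqF.
(* With [M = n - 2], [S = |g_x|^2] and [Z = g_t^2], maximality says [u PA + PB + 2 PC <= 0], while
   the left side is at least [(M + 1) u^2 + M u^2 S + (M + 3) Z + 2 eps > 0]. Any factor above 1 in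
   place of the 2 in front of [horiz] would also give a positive sum. *)
have uP : u * PA = - ((M + 1) * u ^+ 2 * (1 + S)) - M * Z.
  have -> : PA = - ((M + 1) * u * (1 + S)) - M * (Z / u) by lra.
  by rewrite mulrBr uZ; ring.
have u2 : 0 < u ^+ 2 by rewrite exprn_gt0.
have MS : 0 <= M * S by rewrite mulr_ge0.
have MZ : 0 <= M * Z by rewrite mulr_ge0.
have uS : 0 <= u ^+ 2 * S by rewrite mulr_ge0// ltW.
have uMS : 0 <= u ^+ 2 * (M * S) by rewrite mulr_ge0// ltW.
have uM : 0 <= u ^+ 2 * M by rewrite mulr_ge0// ltW.
nra.
Qed.

(** * The logarithmic barrier *)

(** The solution of [psi'' = - k psi'^2] with [psi 0 = 0] and [psi' 0 = K / k]. *)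
Definition log_barrier (R : realType) (K k s : R) : R := ln (1 + K * s) / k.

Lemma is_derive_affine (R : realType) (c K t : R) : is_derive t 1 (fun t : R => c + K * t) K.
Proof.
apply/is_derive_epsP => e e0; exists 1 => // h _.
rewrite -[h *: 1]/(h * 1) (_ : _ - _ = 0); last by ring.
by rewrite normr0 mulr_ge0// ltW.
Qed.

Lemma is_derive_log_barrier (R : realType) (K k t : R) : 0 < 1 + K * t ->
  is_derive t 1 (log_barrier K k) (K / (1 + K * t) / k).
Proof.
move=> t0; have lnd := @is_derive1_comp R (@ln R) (fun t => 1 + K * t) t _ _
  (is_derive1_ln t0) (is_derive_affine 1 K t).
rewrite (_ : log_barrier K k = k^-1 \*: (@ln R \o (fun t => 1 + K * t))); last first.
  by apply/funext => r; rewrite /log_barrier /= mulrC.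
rewrite (_ : _ / k = k^-1 *: ((1 + K * t)^-1 * K)); first exact: is_deriveZ.
by rewrite /GRing.scale /= mulrC [K / _]mulrC.
Qed.

Lemma jet2_log_barrier (R : realType) (K k s : R) : 0 < K -> 0 < k -> 0 < s ->
  let b := K / (1 + K * s) / k in
  jet2 (log_barrier K k : R^o -> R) s (fun v => b * v) (fun v => - k * b ^+ 2 * v ^+ 2).
Proof.
move=> K0 k0 s0 b.
have pos t : 0 < t -> 0 < 1 + K * t by move=> t0; rewrite ltr_pwDl// mulr_ge0 ?ltW.
apply: (@jet2_1D R _ (fun t => K / (1 + K * t) / k) (s : R^o) (- k * b ^+ 2) s s0).
  by move=> t; rewrite ltr_norml => /andP[ts _]; apply/is_derive_log_barrier/pos; lra.
have nz : 1 + K * s != 0 by rewrite gt_eqF// pos.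
rewrite (_ : (fun t => _) = (K / k) \*: (fun y => (1 + K * y)^-1)); last first.
  by apply/funext => r; rewrite /GRing.scale /= mulrAC.
rewrite (_ : - k * b ^+ 2 = K / k *: (- (1 + K * s) ^- 2 *: K)).
  exact/is_deriveZ/(@is_deriveV R (fun t => 1 + K * t) s K 1 nz (is_derive_affine 1 K s)).
by rewrite /b /GRing.scale /=; field; rewrite nz gt_eqF.
Qed.

(** A threshold for [k]: where the barrier has slope [b >= 1], this number times [b^2] bounds
    everything that competes with the gain from [k]. Since [|g_i| <= (G + 1) b] there, [L b^2]
    bounds each squared derivative. The first two summands come from the lower-order terms; the last
    is the dimension times [S] times a bound for the trace of the coefficients, for the Hessian of
    [phi]. *)
Definition barrier_slope (R : realType) n (m0 M G S : R) : R :=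
  let N := n.-1%:R in let L := (G + 1) ^+ 2 in
  N * M * (1 + N * L) + (n - 2)%:R * (L / m0)
  + n.-1.+1%:R * S * ((M ^+ 2 + 1) * N + M ^+ 2 * (n.-1.-1%:R * (N * L)) + N * L + N * L + 1).

(** The real arithmetic of the barrier argument. In the application [u = g x], [u2 = u^2], [b2] is
    the squared slope, [X = |g_x|^2], [Z = g_t^2], [Y = g_t^2 / g]; [A], [B], [D], [W] are the
    principal parts at the Hessian of [g], the Hessian of [phi], the squared norm and the square of
    [dotp a]. *)
Lemma barrier_slope_arith (R : realType) n (m0 M G S : R) (u u2 b2 eps k c sigma X Z Y A B D W : R) :
  0 <= u -> u <= M -> 0 <= u2 -> u2 <= M ^+ 2 -> 1 <= b2 -> 0 <= (G + 1) ^+ 2 -> 0 <= S ->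
  eps <= 1 -> 1 <= n.-1%:R :> R -> 0 <= k -> `|sigma| = 1 ->
  0 <= X -> X <= n.-1%:R * (G + 1) ^+ 2 * b2 -> 0 <= Z -> Z <= (G + 1) ^+ 2 * b2 -> 0 <= Y -> Y <= (G + 1) ^+ 2 / m0 * b2 ->
  c <= W ->
  sigma * (A - B) + k * b2 * W <= 0 ->
  `|B| <= n.-1.+1%:R * S * D ->
  D = u2 * n.-1%:R + eps + u2 * (n.-1.-1%:R * X) + n.-1%:R * Z + (X + 1) ->
  0 = A + n.-1%:R * u * (1 + X) + (n - 2)%:R * Y ->
  k * c <= barrier_slope n m0 M G S.
Proof.
pose N : R := n.-1%:R; pose L := (G + 1) ^+ 2; rewrite -/N -/L.
move=> u0 uM u20 u2M b1 L0 S0 e1 N1 k0 sn X0 XL Z0 ZL Y0 YL cW PH HB HD HA.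
have b20 : 0 < b2 by lra.
have N0 : 0 <= N by lra.
have n20 : 0 <= (n - 2)%:R :> R by [].
have nn0 : 0 <= n.-1.-1%:R :> R by [].
have d0 : 0 <= n.-1.+1%:R :> R by [].
rewrite /barrier_slope -/N -/L.
move: (n - 2)%:R n.-1.-1%:R n.-1.+1%:R (L / m0) n20 nn0 d0 YL HB HD HA.
move: N L N0 N1 L0 XL ZL => N L N0 N1 L0 XL ZL n2 nn d L' n20 nn0 d0 YL HB HD HA.
have M0 : 0 <= M by lra.
have NL : 0 <= N * L by rewrite mulr_ge0.
(* All terms are compared after multiplication by [b2]; those without derivatives are absorbed
   through [1 <= b2]. *)
rewrite -(ler_pM2r b20).
have E1 : N * u * (1 + X) <= N * M * (1 + N * L) * b2.
  rewrite -[leRHS]mulrA; apply: ler_pM; rewrite ?mulr_ge0 ?addr_ge0 ?ler_wpM2l//.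
  by rewrite mulrDl mul1r lerD.
have E2 : n2 * Y <= n2 * L' * b2 by rewrite -mulrA ler_wpM2l.
have E3 : D <= ((M ^+ 2 + 1) * N + M ^+ 2 * (nn * (N * L)) + N * L + N * L + 1) * b2.
  rewrite HD !mulrDl.
  have F1 : u2 * N <= M ^+ 2 * N * b2.
    rewrite -[leLHS]mulr1; apply: ler_pM; rewrite ?mulr_ge0 ?ler_wpM2r//.
  have F2 : eps <= 1 * N * b2 by rewrite mul1r (le_trans e1)// mulr_ege1.
  have F3 : u2 * (nn * X) <= M ^+ 2 * (nn * (N * L)) * b2.
    rewrite -mulrA -[nn * (N * L) * b2]mulrA; apply: ler_pM; rewrite ?mulr_ge0 ?ler_wpM2l//.
  have F4 : N * Z <= N * L * b2 by rewrite -mulrA ler_wpM2l.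
  lra.
have E4 : k * c * b2 <= k * b2 * W.
  by rewrite mulrAC ler_wpM2l// mulr_ge0// ltW.
have E5 : `|A - B| <= N * u * (1 + X) + n2 * Y + d * S * D.
  apply: le_trans (ler_normB _ _) _; apply: lerD HB.
  have -> : A = - (N * u * (1 + X) + n2 * Y) by lra.
  by rewrite normrN ger0_norm// addr_ge0 ?mulr_ge0// addr_ge0.
have E6 : - (sigma * (A - B)) <= `|A - B|.
  by apply: le_trans (ler_norm _) _; rewrite normrN normrM sn mul1r.
have E7 : d * S * D <= d * S * ((M ^+ 2 + 1) * N + M ^+ 2 * (nn * (N * L)) + N * L + N * L + 1) * b2.
  by rewrite -[leRHS]mulrA ler_wpM2l// mulr_ge0.
lra.
Qed.

Lemma hess_form_le (R : realType) d (f : 'rV[R]_d.+1 -> R) x v (S : R) :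
  (forall i j, `|partial j (partial i f) x| <= S) ->
  `|hess_form f x v| <= d.+1%:R * S * dotp v v.
Proof.
move=> H; have S0 : 0 <= S := le_trans (normr_ge0 _) (H ord0 ord0).
apply: (@le_trans _ _ (\sum_i \sum_j S * ((v 0 i ^+ 2 + v 0 j ^+ 2) / 2))).
  rewrite /hess_form; apply: le_trans (ler_norm_sum _ _ _) _; apply: ler_sum => i _.
  rewrite mulr_sumr; apply: le_trans (ler_norm_sum _ _ _) _; apply: ler_sum => j _.
  rewrite mulrA normrM mulrC; apply: ler_pM => //.
  rewrite normrM -(real_normK (num_real (v 0 i))) -(real_normK (num_real (v 0 j))).
  by have := sqr_ge0 (`|v 0 i| - `|v 0 j|); nra.
have -> : dotp v v = \sum_i v 0 i ^+ 2 by apply: eq_bigr => i _; rewrite expr2.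
under eq_bigr do rewrite -mulr_sumr -mulr_suml big_split /= sumr_const card_ord.
rewrite -mulr_sumr -mulr_suml big_split /= sumr_const card_ord sumrMnl.
by rewrite -[_ *+ d.+1]mulr_natl le_eqVlt; apply/orP; left; apply/eqP; field.
Qed.

(** [sigma] is 1 or -1, so upper and lower barriers are treated together. This works because only
    the size of the terms competing with [k] is used, never their sign. *)
Lemma no_interior_barrier_max (R : realType) n (U : set 'rV[R]_n.-1.+1)
    (g phi : 'rV[R]_n.-1.+1 -> R) (a : 'rV[R]_n.-1.+1) (eps m0 M G S K k beta sigma : R) x :
  (2 <= n)%N -> open U -> Ck 2 U g -> Ck 2 U phi -> U x -> 0 <= eps <= 1 ->
  0 < m0 -> m0 <= g x <= M -> M_op eps g x = 0 ->
  (forall i, `|partial i phi x| <= G) ->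
  (forall i j, `|partial j (partial i phi) x| <= S) ->
  dotp a a = 1 -> sigma ^+ 2 = 1 -> 0 < K -> 0 < k ->
  barrier_slope n m0 M G S < k * Num.min (m0 ^+ 2) 1 ->
  0 < dotp a x - beta -> 1 <= K / (1 + K * (dotp a x - beta)) / k ->
  ~ (forall y, U y ->
       sigma * (g y - phi y) - log_barrier K k (dotp a y - beta) <=
       sigma * (g x - phi x) - log_barrier K k (dotp a x - beta)).
Proof.
move=> n2 oU gC phiC Ux /andP[e0 e1] m00 /andP[mg gM] Mg HG HS aa ss K0 k0 kT l0 b1 fmax.
set b := K / _ / k in b1.
have g0 : 0 < g x by apply: lt_le_trans mg.
have := jet2D (jet2Z sigma (jet2D (Ck2_jet2 oU gC Ux) (jet2Z (-1) (Ck2_jet2 oU phiC Ux))))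
  (jet2Z (-1) (@jet2_comp_affine R _ R^o _ (fun y => dotp a y - beta) (dotp a) x _ _
     (jet2_log_barrier K0 k0 l0) _)).
rewrite -/b => /(_ _) J.
have {}J := J (fun t v => ltac:(by rewrite dotpDr dotpZr addrAC)).
have fmax' y : U y -> sigma * (g y + -1 * phi y) + -1 * (log_barrier K k \o (fun y => dotp a y - beta)) y <=
   sigma * (g x + -1 * phi x) + -1 * (log_barrier K k \o (fun y => dotp a y - beta)) x.
  by rewrite !mulN1r; exact: fmax.
have {fmax fmax'} J := jet2_max oU Ux fmax' J.
clearbody b.
have b0 : 0 < b by apply: lt_le_trans b1.
(* The first derivative of the difference vanishes; multiplying by [sigma] and using [sigma^2 = 1]
   solves for [Dg]. *)
have grad_eq i : grad g x 0 i = partial i phi x + sigma * b * a 0 i.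
  have := (J (delta_mx 0 i)).1; rewrite /= !dotp_delta !mxE => E.
  have : sigma * (partial i g x - partial i phi x) = b * a 0 i by lra.
  move/(congr1 (fun z => sigma * z)); rewrite mulrA -expr2 ss mul1r; lra.
have a1 i : `|a 0 i| <= 1.
  rewrite -(@ler_pXn2r _ 2) ?nnegrE// expr1n real_normK ?num_real// -aa /dotp (bigD1 i)//=.
  by rewrite -expr2 lerDl sumr_ge0// => j _; rewrite -expr2 sqr_ge0.
have G0 : 0 <= G := le_trans (normr_ge0 _) (HG ord0).
have S0 : 0 <= S := le_trans (normr_ge0 _) (HS ord0 ord0).
have sn : `|sigma| = 1.
  by apply/eqP; rewrite -(@eqrXn2 _ 2)// expr1n real_normK ?num_real// ss.
set L := (G + 1) ^+ 2.
(* From [grad_eq], [|g_i| <= G + b <= (G + 1) b], because [b >= 1]. *)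
have q2 i : grad g x 0 i ^+ 2 <= L * b ^+ 2.
  rewrite -exprMn -(real_normK (num_real (grad g x 0 i))) ler_pXn2r ?nnegrE//; last first.
    by rewrite mulr_ge0 ?(ltW b0)// addr_ge0.
  rewrite grad_eq; apply: le_trans (ler_normD _ _) _.
  rewrite !normrM sn (gtr0_norm b0) mul1r.
  have := HG i; have := a1 i; nra.
pose P Q := principal eps (g x) (grad g x) Q.
have PH : sigma * (P (hess_form g x) - P (hess_form phi x))
    + k * b ^+ 2 * P (fun v => dotp a v ^+ 2) <= 0.
  have Hv v : sigma * (hess_form g x v + -1 * hess_form phi x v)
      + k * b ^+ 2 * dotp a v ^+ 2 <= 0 * diag_form 0 v.
    have [_ /=] := J v.
    by move: (hess_form g x v) (hess_form phi x v) (dotp a v) => A B C; rewrite mul0r; lra.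
  have Z := principalZ eps (g x) 0 (grad g x) (diag_form 0); rewrite mul0r in Z.
  rewrite -[leRHS]Z -mulN1r /P -!principalZ -principalD -principalZ -principalD.
  exact: principal_le e0 Hv.
have Pphi : `|P (hess_form phi x)| <= n.-1.+1%:R * S * P (diag_form 1).
  have H v := hess_form_le v HS.
  rewrite ler_norml -mulNr /P -!principalZ.
  apply/andP; split; apply: principal_le => // v; have := H v;
    by rewrite dotp_diag ler_norml => /andP[? ?]; rewrite ?mulNr.
have Pa : Num.min (m0 ^+ 2) 1 <= P (fun v => dotp a v ^+ 2).
  apply: le_trans (principal_sqr_dotp (g x) (grad g x) a e0).
  have := aa; rewrite /dotp sum_xi_ti -expr2.
  under eq_bigr do rewrite -expr2.
  have : 0 <= \sum_k a 0 (xi k) ^+ 2 by rewrite sumr_ge0// => j _; rewrite sqr_ge0.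
  have : 0 <= a 0 ti ^+ 2 by rewrite sqr_ge0.
  have : m0 ^+ 2 <= g x ^+ 2 by rewrite ler_pXn2r ?nnegrE ?(ltW m00) ?(ltW g0).
  move: (\sum_k _) (a 0 ti ^+ 2) (g x ^+ 2) (m0 ^+ 2) => A B C D DC B0 A0 AB.
  have : Num.min D 1 <= D by rewrite ge_min lexx.
  have : Num.min D 1 <= 1 by rewrite ge_min lexx orbT.
  move: (Num.min D 1) => E E1 ED.
  rewrite -[E]mulr1 -AB mulrDr lerD ?ler_wpM2r//; last by rewrite ler_piMl.
  exact: le_trans DC.
have := M_opE eps oU gC Ux; rewrite Mg -/(P (hess_form g x)).
have P1 := principal_diag eps (g x) 1 (grad g x); rewrite -/(P (diag_form 1)) in P1.
have sumq : \sum_k grad g x 0 (xi k) ^+ 2 <= n.-1%:R * L * b ^+ 2.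
  apply: le_trans (ler_sum _ (fun k _ => q2 (xi k))) _.
  by rewrite sumr_const card_ord -[leLHS]mulr_natl mulrA.
have sumq0 : 0 <= \sum_k grad g x 0 (xi k) ^+ 2.
  by apply: sumr_ge0 => j _; rewrite sqr_ge0.
have N1 : 1 <= n.-1%:R :> R by rewrite ler1n; case: (n) n2 => [|[]].
have bb : 1 <= b ^+ 2 by rewrite exprn_ege1.
have L0 : 0 <= L by rewrite sqr_ge0.
have Zq := q2 ti.
have Z0 : 0 <= grad g x 0 ti ^+ 2 by rewrite sqr_ge0.
have Zu : grad g x 0 ti ^+ 2 / g x <= L / m0 * b ^+ 2.
  rewrite [leRHS]mulrAC ler_pM ?invr_ge0 ?(ltW g0)//.
  by rewrite lef_pV2 ?posrE.
have Zu0 : 0 <= grad g x 0 ti ^+ 2 / g x by rewrite divr_ge0 ?(ltW g0).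
have eN : eps / n.-1%:R * n.-1%:R = eps.
  by rewrite divfK// gt_eqF// (lt_le_trans ltr01).
move: P1; rewrite [(_ + eps / _) * _]mulrDl eN mul1r => P1 E.
move: kT; rewrite ltNge => /negP; apply.
have gM2 : g x ^+ 2 <= M ^+ 2.
  by rewrite ler_pXn2r ?nnegrE ?(ltW g0)// (le_trans _ gM) ?(ltW g0).
exact: (barrier_slope_arith (ltW g0) gM (sqr_ge0 _) gM2 bb (sqr_ge0 (G + 1)) S0 e1 N1
  (ltW k0) sn sumq0 sumq Z0 Zq Zu0 Zu Pa PH Pphi P1 E).
Qed.

(** * From a bound inside the domain to the gradient on its boundary *)

Lemma dotp_norm_le (R : realType) d (u v : 'rV[R]_d) (e : R) :
  (forall i, `|u 0 i| <= e) -> `|dotp u v| <= e * \sum_i `|v 0 i|.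
Proof.
move=> H; rewrite mulr_sumr; apply: le_trans (ler_norm_sum _ _ _) _; apply: ler_sum => i _.
by rewrite normrM ler_wpM2r.
Qed.

(* Chain rule at [p] for the last coordinate of [psi \o chi = id]. *)
Lemma straightening_transversal (R : realType) d (V W : set 'rV[R]_d.+1)
    (psi chi : 'rV[R]_d.+1 -> 'rV[R]_d.+1) p :
  open V -> open W -> V p -> W (psi p) -> chi (psi p) = p ->
  (forall y, W y -> V (chi y) /\ psi (chi y) = y) ->
  Ck 1 V (fun x => psi x 0 ord_max) -> (forall i, Ck 1 W (fun y => chi y 0 i)) ->
  dotp (grad (fun x => psi x 0 ord_max) p)
       (\row_i partial ord_max (fun y => chi y 0 i) (psi p)) = 1.
Proof.
move=> oV oW Vp Wq chiq HW psiC chiC.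
set rho := fun x => _; set v0 := \row_i _; set D := grad rho p; set q := psi p in Wq chiq *.
apply/eqP; rewrite -subr_eq0; apply/eqP.
apply: (@ler_eps_eq0 _ _ (`|v0| + 1 + \sum_i `|D 0 i|)) => e e0.
(* [e' <= e] serves the final error, [e' <= 1] bounds the increment [h] by [t (|v0| + 1)]. *)
pose e' := Num.min e 1.
have e'0 : 0 < e' by rewrite lt_min e0 ltr01.
have [r r0 Hr] := C1_strict oV psiC Vp e0.
have [s s0 Hs] : exists2 s : R, 0 < s & forall t : R, `|t| < s -> forall i,
    `|chi (q + t *: delta_mx 0 ord_max) 0 i - p 0 i - t * v0 0 i| <= e' * `|t|.
  have [s s0 Hs] : exists2 s : R, 0 < s & forall t : R, `|t - 0| < s -> forall i,
      `|chi (q + t *: delta_mx 0 ord_max) 0 i - p 0 i - t * v0 0 i| <= e' * `|t|.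
    apply: (@near_all _ _ R^o) => i; apply/nbhs_ballP.
    have /is_derive_epsP/(_ _ e'0)[s s0 Hs] := Ck_is_derive ord_max (chiC i) Wq.
    exists s => //= t; rewrite /ball /= sub0r normrN => /Hs; rewrite chiq.
    by rewrite mxE.
  by exists s => // t ts; apply: Hs; rewrite subr0.
have [s' s'0 Hs'] := open_line (delta_mx 0 ord_max) oW Wq.
pose t := Num.min (Num.min s s') (r / (`|v0| + 1)) / 2.
have v1 : 0 < `|v0| + 1 by rewrite ltr_wpDl.
have m0 : 0 < Num.min (Num.min s s') (r / (`|v0| + 1)) by rewrite !lt_min s0 s'0 divr_gt0.
have t0 : 0 < t by rewrite divr_gt0.
have : t < Num.min (Num.min s s') (r / (`|v0| + 1)) by rewrite /t; lra.
rewrite !lt_min => /andP[/andP[ts ts'] tr].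
have tn : `|t| = t by rewrite gtr0_norm.
have := Hs t; rewrite tn => /(_ ts) Ht; have := Hs' t; rewrite tn => /(_ ts') Wt.
set h := chi (q + t *: delta_mx 0 ord_max) - p.
have hh i : `|(h - t *: v0) 0 i| <= e' * t by have := Ht i; rewrite !mxE.
have hn : `|h| <= t * (`|v0| + 1).
  rewrite -[h](subrK (t *: v0)); apply: le_trans (ler_normD _ _) _.
  rewrite normrZ tn mulrDr mulr1 addrC lerD2l; apply: rV_norm_le => [|i]; first exact: ltW.
  by apply: le_trans (hh i) _; rewrite ler_piMl ?(ltW t0)// /e' ge_min lexx orbT.
have hr : `|h| < r by apply: le_lt_trans hn _; rewrite -ltr_pdivlMr.
have := Hr p h; rewrite subrr normr0 [p + h - p]addrAC subrr add0r => /(_ r0 hr).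
have -> : rho (p + h) - rho p = t.
  rewrite /rho /h [p + _]addrC subrK; have [_ ->] := HW _ Wt; rewrite -/q.
  by rewrite !mxE !eqxx mulr1 addrAC subrr add0r.
move=> H; rewrite -(ler_pM2l t0).
have -> : t * `|dotp D v0 - 1| = `|(t - dotp D h) + dotp D (h - t *: v0)|.
  by rewrite (dotpBr _ h) dotpZr -[X in X * _ = _]tn -normrM -[RHS]normrN; congr `|_|; ring.
apply: le_trans (ler_normD _ _) _.
have H2 : `|dotp D (h - t *: v0)| <= e' * t * \sum_i `|D 0 i|.
  rewrite (_ : dotp D _ = dotp (h - t *: v0) D); first exact: dotp_norm_le.
  by apply: eq_bigr => i _; rewrite mulrC.
have B0 : 0 <= \sum_i `|D 0 i| by rewrite sumr_ge0.
have ee : e' <= e by rewrite ge_min lexx.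
have H3 : e' * t * \sum_i `|D 0 i| <= e * t * \sum_i `|D 0 i|.
  by rewrite ler_wpM2r// ler_wpM2r// ltW.
have H4 : e * `|h| <= e * (t * (`|v0| + 1)) by rewrite ler_wpM2l// ltW.
lra.
Qed.

(* Along a direction [v] entering [U], the segment from [p + s t v] to [p + t v]
   lies in [U]; the hypothesis controls [w] at both of its ends. *)
Lemma entering_direction_bound (R : realType) d (U V : set 'rV[R]_d.+1)
    (rho w : 'rV[R]_d.+1 -> R) (Dw : 'rV[R]_d.+1 -> 'rV[R]_d.+1) (a p W v : 'rV[R]_d.+1) (E : R) :
  open V -> V p -> Ck 1 V rho -> rho p = 0 -> (forall x, V x -> 0 < rho x -> U x) ->
  0 < dotp (grad rho p) v ->
  (forall x u, U x -> is_derive x u w (dotp (Dw x) u)) ->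
  (forall e : R, 0 < e -> exists2 r : R, 0 < r & forall x, U x -> `|x - p| < r ->
      forall i, `|Dw x 0 i - W 0 i| <= e) ->
  (forall x, U x -> `|w x| <= E * dotp a (x - p)) ->
  `|dotp W v| <= E * dotp a v.
Proof.
move=> oV Vp rhoC rp Urho c0 Hw HW HE.
have [r r0 Hr] : exists2 r : R, 0 < r & forall t, 0 < t < r -> U (p + t *: v).
  have /is_derive_epsP/(_ _ (divr_gt0 c0 (ltr0Sn _ 1)))[r r0 Hr] := C1_is_derive v oV rhoC Vp.
  have [s s0 Hs] := open_line v oV Vp.
  exists (Num.min r s); first by rewrite lt_min r0.
  move=> t; rewrite lt_min => /and3P[t0 tr ts].
  have := Hr t; rewrite (gtr0_norm t0) => /(_ tr).
  have := Hs t; rewrite (gtr0_norm t0) => /(_ ts) Vt.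
  rewrite rp subr0 ler_norml => /andP[H _]; apply: Urho => //.
  have : 0 < dotp (grad rho p) v * t by rewrite mulr_gt0.
  lra.
set A := `|dotp W v|; set B := E * dotp a v.
(* The segment starts at parameter [e t] instead of 0 because nothing is assumed about [w] at [p]
   itself. Its increment is [(1 - e) t] times a derivative within [e] of [dotp W v], and the two end
   values add up to at most [(1 + e) t B]. *)
have key e : 0 < e < 1 -> (1 - e) * (A - e) <= (1 + e) * B.
  move=> /andP[e0 e1].
  have sv : 0 < 1 + \sum_i `|v 0 i| by rewrite ltr_pwDl// sumr_ge0.
  have [q q0 Hq] := HW _ (divr_gt0 e0 sv).
  have v1 : 0 < 1 + `|v| by rewrite ltr_pwDl.
  pose t := Num.min r (q / (1 + `|v|)) / 2.
  have m0 : 0 < Num.min r (q / (1 + `|v|)) by rewrite lt_min r0 divr_gt0.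
  have t0 : 0 < t by rewrite divr_gt0.
  have : t < Num.min r (q / (1 + `|v|)) by rewrite /t; lra.
  rewrite lt_min ltr_pdivlMr// => /andP[tr tq].
  have inU s : 0 < s <= 1 -> U (p + (s * t) *: v).
    by move=> /andP[s0 s1]; apply: Hr; rewrite mulr_gt0//= (le_lt_trans _ tr)// ger_pMl.
  have [|c /andP[c0' c1] Hc] := @MVT_line_is_derive R _ w (p + (e * t) *: v) (((1 - e) * t) *: v)
      (fun s => (1 - e) * t * dotp (Dw (p + ((e + s * (1 - e)) * t) *: v)) v).
    move=> s /andP[s0 s1]; apply: is_derive_scale.
    rewrite (_ : p + _ + s *: _ = p + ((e + s * (1 - e)) * t) *: v); last first.
      by rewrite -[LHS]addrA scalerA -scalerDl; congr (_ + _ *: _); ring.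
    apply/Hw/inU.
    by apply/andP; split; nra.
  rewrite -addrA -scalerDl in Hc.
  rewrite (_ : e * t + (1 - e) * t = 1 * t) in Hc; last by ring.
  have U1 := inU 1 ltac:(by rewrite ltr01 lexx).
  have Ue := inU e ltac:(by rewrite e0 ltW).
  have Uc := inU (e + c * (1 - e)) ltac:(apply/andP; split; nra).
  have := HE _ U1; have := HE _ Ue.
  rewrite ![p + _ - p]addrAC subrr !add0r !dotpZr => H1 H2.
  have : `|(p + ((e + c * (1 - e)) * t) *: v) - p| < q.
    rewrite addrAC subrr add0r normrZ normrM (gtr0_norm t0).
    apply: le_lt_trans tq; apply: ler_pM => //; last by rewrite ler_wpDl.
      by rewrite mulr_ge0// ltW.
    rewrite ger_pMl// ler_norml; apply/andP; split; nra.
  move=> /(Hq _ Uc) Hd.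
  have Hd' : `|dotp (Dw (p + ((e + c * (1 - e)) * t) *: v) - W) v| <= e.
    have Hd2 i : `|(Dw (p + ((e + c * (1 - e)) * t) *: v) - W) 0 i| <= e / (1 + \sum_i `|v 0 i|).
      by rewrite !mxE; exact: Hd.
    apply: le_trans (dotp_norm_le v Hd2) _.
    by rewrite mulrAC ler_pdivrMr// ler_pM2l// ler_wpDl.
  rewrite dotpBl in Hd'.
  set X := dotp (Dw _) v in Hd' Hc.
  have AX : A <= `|X| + e.
    rewrite /A -[dotp W v](subKr X); apply: le_trans (ler_normB _ _) _.
    by rewrite lerD2l.
  have HX : (1 - e) * t * `|X| <= (1 + e) * t * B.
    have -> : (1 - e) * t * `|X| = `|(1 - e) * t * X|.
      by rewrite [RHS]normrM gtr0_norm// mulr_gt0// subr_gt0.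
    rewrite -Hc; apply: le_trans (ler_normB _ _) _; rewrite /B; lra.
  rewrite -(ler_pM2r t0) mulrAC [leRHS]mulrAC; apply: le_trans HX.
  apply: ler_wpM2l; last by rewrite lerBlDr.
  by apply: mulr_ge0; [rewrite subr_ge0|]; exact: ltW.
have A0 : 0 <= A by exact: normr_ge0.
rewrite leNgt; apply/negP => BA.
(* [key] forces [A - B <= e (1 + A + B)], which this [e] contradicts when [B < A]. *)
pose e := Num.min (1 / 2) ((A - B) / (2 * (2 + A + `|B|))).
have den : 0 < 2 * (2 + A + `|B|).
  by have := normr_ge0 B; lra.
have e0 : 0 < e by rewrite lt_min !divr_gt0 ?subr_gt0.
have e1 : e < 1 by rewrite gt_min; apply/orP; left; lra.
have : e * (2 * (2 + A + `|B|)) <= A - B by rewrite -ler_pdivlMr// /e ge_min lexx orbT.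
have := key e ltac:(by rewrite e0 e1).
have := ler_norm B; have := normr_ge0 B.
nra.
Qed.

(** One of [e_i] and [- e_i] points weakly into the domain; a small multiple of [v0] makes it enter
    strictly, so that [entering_direction_bound] applies, and the multiple then tends to 0.
    Tangential and normal derivatives are thus handled alike. *)
Lemma boundary_gradient_bound (R : realType) d (U V : set 'rV[R]_d.+1)
    (rho w : 'rV[R]_d.+1 -> R) (Dw : 'rV[R]_d.+1 -> 'rV[R]_d.+1) (a p W v0 : 'rV[R]_d.+1) (E : R) :
  open V -> V p -> Ck 1 V rho -> rho p = 0 -> (forall x, V x -> 0 < rho x -> U x) ->
  dotp (grad rho p) v0 = 1 ->
  (forall x u, U x -> is_derive x u w (dotp (Dw x) u)) ->
  (forall e : R, 0 < e -> exists2 r : R, 0 < r & forall x, U x -> `|x - p| < r ->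
      forall i, `|Dw x 0 i - W 0 i| <= e) ->
  0 <= E -> (forall i, `|a 0 i| <= 1) ->
  (forall x, U x -> `|w x| <= E * dotp a (x - p)) ->
  forall i, `|W 0 i| <= E.
Proof.
move=> oV Vp rhoC rp Urho v01 Hw HW E0 a1 HE i.
have dir v := @entering_direction_bound R d U V rho w Dw a p W v E oV Vp rhoC rp Urho.
have [sg sg1 sgD] : exists2 sg : R, `|sg| = 1 & 0 <= sg * grad rho p 0 i.
  case: (leP 0 (grad rho p 0 i)) => D0; first by exists 1; rewrite ?normr1 ?mul1r.
  by exists (-1); rewrite ?normrN1// mulN1r oppr_ge0 ltW.
apply/ler_addgt0Pr => e e0.
(* With this [c] the perturbation [(e / c) v0] costs at most [e] in total. *)
pose c := E * `|dotp a v0| + `|dotp W v0| + 1.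
have c0 : 0 < c by rewrite ltr_wpDl// addr_ge0// mulr_ge0.
have s0 : 0 < e / c by rewrite divr_gt0.
have := dir (sg *: delta_mx 0 i + (e / c) *: v0).
rewrite !dotpDr !dotpZr !dotp_delta v01 mulr1 => /(_ ltac:(by rewrite ltr_wpDl) Hw HW HE).
move=> H.
have Wi : `|W 0 i| = `|sg * W 0 i| by rewrite normrM sg1 mul1r.
rewrite Wi -[sg * _](addrK (e / c * dotp W v0)).
apply: le_trans (ler_normB _ _) _; apply: le_trans (lerD H (lexx _)) _.
rewrite normrM (gtr0_norm s0).
have ai : sg * a 0 i <= 1.
  by apply: le_trans (ler_norm _) _; rewrite normrM sg1 mul1r.
have : E * (sg * a 0 i) <= E by rewrite ler_piMr.
have : E * (e / c * dotp a v0) <= e / c * (E * `|dotp a v0|).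
  by rewrite mulrCA ler_wpM2l ?(ltW s0)// ler_wpM2l// ler_norm.
have : e / c * c = e by rewrite divfK// gt_eqF.
rewrite {2}/c => ec; nra.
Qed.

(** * Closures, compactness and continuous extensions *)

Lemma within_continuous_eps (R : realType) d (A : set 'rV[R]_d.+1) (F : 'rV[R]_d.+1 -> R) x :
  {within A, continuous F} -> A x ->
  forall e : R, 0 < e -> exists2 r : R, 0 < r &
    forall y, A y -> `|y - x| < r -> `|F y - F x| <= e.
Proof.
move=> Fc Ax e e0; have /cvgrPdist_le/(_ _ e0) := Fc x.
rewrite /from_subspace /= => H.
have : \forall y \near within A (nbhs x), `|F x - F y| <= e.
  by rewrite nbhs_subspace_in.
rewrite near_withinE => /nbhs_ballP[r /= r0 Hr].
exists r => // y Ay yx; rewrite distrC; apply: (Hr y) Ay.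
by rewrite -ball_normE /= distrC.
Qed.

Lemma closure_ge (R : realType) d (U : set 'rV[R]_d.+1) (F : 'rV[R]_d.+1 -> R) c :
  {within closure U, continuous F} -> (forall x, U x -> c <= F x) ->
  forall x, closure U x -> c <= F x.
Proof.
move=> Fc H x cx; apply/ler_addgt0Pr => e e0.
have [r r0 Hr] := within_continuous_eps Fc cx e0.
have [y [Uy]] := cx _ (nbhsx_ballx x r r0).
rewrite -ball_normE /= distrC => /(Hr y (subset_closure Uy)).
by rewrite ler_norml => /andP[_]; have := H _ Uy; lra.
Qed.

Lemma closure_le (R : realType) d (U : set 'rV[R]_d.+1) (F : 'rV[R]_d.+1 -> R) c :
  {within closure U, continuous F} -> (forall x, U x -> F x <= c) ->
  forall x, closure U x -> F x <= c.
Proof.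
move=> Fc H x cx; rewrite -lerN2; apply: (closure_ge (U := U) (F := \- F)) => //.
  by move=> y; apply: continuousN; exact: Fc.
by move=> y Uy; rewrite /= lerN2 H.
Qed.

Lemma compact_closure_bounded (R : realType) d (U : set 'rV[R]_d.+1) :
  bounded_set U -> compact (closure U).
Proof.
move=> [M [_ HM]]; apply: bounded_closed_compact; last exact: closed_closure.
exists M; split=> [|y My x cx /=]; first exact: num_real.
apply: (closure_le (U := U) (F := fun z => `|z|)) cx.
  by apply: continuous_subspaceT => z; exact: norm_continuous.
by move=> z Uz; exact: HM My z Uz.
Qed.

Lemma bdry_open (R : realType) d (U : set 'rV[R]_d.+1) : open U -> bdry U = closure U `\` U.
Proof. by move=> /interior_id oU; rewrite /bdry oU. Qed.

Lemma compact_bdry (R : realType) d (U : set 'rV[R]_d.+1) :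
  bounded_set U -> compact (bdry U).
Proof.
move=> bU; apply: (subclosed_compact _ (compact_closure_bounded bU)); last by move=> x [].
rewrite /bdry setDE; apply: closedI; first exact: closed_closure.
by rewrite closedC; exact: open_interior.
Qed.

Lemma boundary_max (R : realType) d (U : set 'rV[R]_d.+1) (F : 'rV[R]_d.+1 -> R) :
  bounded_set U -> open U -> {within closure U, continuous F} ->
  (forall x, U x -> ~ (forall y, U y -> F y <= F x)) ->
  forall x, U x -> exists2 q, bdry U q & F x <= F q.
Proof.
move=> bU oU Fc Fmax x Ux.
have cx : closure U x by exact: subset_closure.
have [|q /set_mem cq Hq] := compact_EVT_max _ (compact_closure_bounded bU) Fc; first by exists x.
exists q; last by apply: Hq; exact/mem_set.
rewrite bdry_open//; split=> // Uq; apply: Fmax Uq _ => y Uy; apply: Hq.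
by apply/mem_set; exact: subset_closure.
Qed.

Lemma within_closure_image_bounded (R : realType) d (U : set 'rV[R]_d.+1)
    (F : 'rV[R]_d.+1 -> R) :
  bounded_set U -> {within closure U, continuous F} ->
  exists B, forall x, closure U x -> `|F x| <= B.
Proof.
move=> bU Fc.
have [M [_ HM]] := compact_bounded (continuous_compact Fc (compact_closure_bounded bU)).
by exists (M + 1) => x cx; apply: (HM (M + 1)); [rewrite ltrDl|exists x].
Qed.

Lemma cont_ext_bounded (R : realType) d (U : set 'rV[R]_d.+1) (h : 'rV[R]_d.+1 -> R) :
  bounded_set U -> has_cont_ext U h -> exists B, forall x, U x -> `|h x| <= B.
Proof.
move=> bU [H [Hc HE]]; have [B HB] := within_closure_image_bounded bU Hc.
by exists B => x Ux; rewrite -HE//; apply: HB; exact: subset_closure.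
Qed.

(** [bdval] is a [lim], which carries information only once convergence is known; the extension [H]
    supplies it and identifies the limit as [H p]. *)
Lemma bdval_cvg (R : realType) d (U : set 'rV[R]_d.+1) (h : 'rV[R]_d.+1 -> R) p :
  has_cont_ext U h -> closure U p ->
  forall e : R, 0 < e -> exists2 r : R, 0 < r &
    forall x, U x -> `|x - p| < r -> `|h x - bdval U h p| <= e.
Proof.
move=> [H [Hc HE]] cp.
have PF : ProperFilter (within U (nbhs p)) by exact: within_nbhs_proper.
have cvgH : h x @[x --> within U (nbhs p)] --> H p.
  apply/cvgrPdist_le => e e0; rewrite near_withinE.
  have [r r0 Hr] := within_continuous_eps Hc cp e0.
  apply/nbhs_ballP; exists r => // x; rewrite -ball_normE /= distrC => xr Ux.
  by rewrite distrC -HE//; apply: Hr => //; exact: subset_closure.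
rewrite /bdval (cvg_lim _ cvgH)// => e e0.
move/cvgrPdist_le: cvgH => /(_ _ e0); rewrite near_withinE => /nbhs_ballP[r /= r0 Hr].
exists r => // x Ux xr; rewrite distrC; apply: (Hr x) Ux.
by rewrite -ball_normE /= distrC.
Qed.

Lemma coord_sub_continuous (R : realType) d (i : 'I_d) (b : R) :
  continuous (fun y : 'rV[R]_d => y 0 i - b).
Proof.
move=> y; apply: (@continuousB _ _ _ (fun y : 'rV[R]_d => y 0 i) (cst b)).
  exact: coord_continuous.
exact: cst_continuous.
Qed.

Lemma horiz_continuous (R : realType) n (c : 'rV[R]_n.-1.+1) : continuous (horiz c).
Proof.
rewrite /horiz; apply: continuous_big => [|k _]; first exact: add_continuous.
move=> y; apply: (@continuous_comp _ _ _ (fun y : 'rV[R]_n.-1.+1 => y 0 (xi k) - c 0 (xi k))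
  (fun t : R => t ^+ 2)).
  exact: coord_sub_continuous.
exact: exprn_continuous.
Qed.

Lemma dotp_continuous (R : realType) d (a : 'rV[R]_d) : continuous (dotp a).
Proof.
rewrite /dotp; apply: continuous_big => [|k _]; first exact: add_continuous.
move=> y; apply: continuousM; [exact: cst_continuous|exact: coord_continuous].
Qed.

(** * Geometry of the domain: covering disk and inner normals *)

Lemma horiz_xproj (R : realType) n (c y : 'rV[R]_n.-1.+1) :
  dotp (xproj y - xproj c) (xproj y - xproj c) = horiz c y.
Proof. by apply: eq_bigr => k _; rewrite !mxE expr2. Qed.

Lemma enorm_le (R : realType) d (u : 'rV[R]_d) (r : R) :
  0 <= r -> (enorm u <= r) = (dotp u u <= r ^+ 2).
Proof.
move=> r0; have D0 : 0 <= dotp u u by apply: sumr_ge0 => i _; rewrite -expr2 sqr_ge0.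
by rewrite -[in LHS](ger0_norm r0) -sqrtr_sqr ler_psqrt// ?nnegrE ?sqr_ge0.
Qed.

(** For [n <> 2], [r_dom] is an infimum that may not be attained; the extra 1 leaves room for an
    admissible disk, and the boundary is reached by closure. For [n = 2] the centre is the midpoint
    of the range of [x]. Boundedness and non-emptiness make [sup] and [inf] genuine bounds. *)
Lemma r_dom_disk (R : realType) n (U : set 'rV[R]_n.-1.+1) :
  (2 <= n)%N -> bounded_set U -> U !=set0 -> bdry U !=set0 ->
  0 <= r_dom U + 1 /\
  exists c, forall q, bdry U q -> horiz c q <= (r_dom U + 1) ^+ 2.
Proof.
move=> n2 bU [y0 Uy0] [p bp]; rewrite /r_dom; have [E|nn2] := eqVneq n 2%N.
  subst n; set X := (_ @` bdry U).
  have [B HB] := within_closure_image_bounded bU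
    (continuous_subspaceT (@coord_continuous R 1 2 0 ord0)).
  have ubX : has_ubound X.
    by exists B => _ [y [cy _] <-]; apply: le_trans (ler_norm _) (HB y cy).
  have lbX : has_lbound X.
    by exists (- B) => _ [y [cy _] <-]; have := HB y cy; rewrite ler_norml => /andP[].
  have Xs y : bdry U y -> inf X <= y 0 ord0 <= sup X.
    by move=> by_; rewrite (ge_inf lbX) ?(ub_le_sup ubX)//; exists y.
  have r0 : 0 <= (sup X - inf X) / 2 by rewrite divr_ge0// subr_ge0; have /andP[] := Xs p bp; exact: le_trans.
  split; first by rewrite addr_ge0.
  exists (const_mx ((sup X + inf X) / 2)) => q bq.
  rewrite /horiz big_ord1 mxE (_ : xi _ = ord0); last exact/val_inj.
  have /andP[] := Xs q bq; move: (sup X) (inf X) (q 0 ord0) r0 => s i x r0 ix xs.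
  have H1 : 0 <= (s - i) / 2 + 1 - (x - (s + i) / 2) by lra.
  have H2 : 0 <= (s - i) / 2 + 1 + (x - (s + i) / 2) by lra.
  by rewrite -subr_ge0 subr_sqr mulr_ge0.
set S := [set _ | _].
have Slb r : S r -> 0 <= r.
  by move=> [c Uc] /(_ _ Uc); apply: le_trans; rewrite /enorm sqrtr_ge0.
have infS : has_inf S.
  split; last by exists 0 => r /Slb.
  have [B HB] := within_closure_image_bounded bU
    (continuous_subspaceT (@horiz_continuous R n y0)).
  exists (B + 1); exists (xproj y0); first by exists y0.
  have B0 : 0 <= B by apply: le_trans (HB y0 (subset_closure Uy0)).
  move=> _ [y Uy <-]; rewrite /cdisk /= enorm_le ?addr_ge0// horiz_xproj.
  apply: le_trans (ler_norm _) _; apply: le_trans (HB y (subset_closure Uy)) _; nra.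
have [r Sr rS] := inf_adherent ltr01 infS.
have r0 := Slb _ Sr; have [_ [c Uc <-] Hc] := Sr.
split; first by apply: le_trans r0 (ltW rS).
exists c => q [cq _].
apply: (closure_le (continuous_subspaceT (@horiz_continuous R n c))) cq => y Uy.
apply: (@le_trans _ _ (r ^+ 2)).
  by rewrite -horiz_xproj -enorm_le//; apply: Hc; exists y.
by rewrite ler_pXn2r ?nnegrE ?(ltW rS)// (le_trans r0 (ltW rS)).
Qed.

(** The strict inequality comes from the hyperplane missing [U]; the sign [s] turns the normal to
    the side of [U]. *)
Lemma supporting_normal (R : realType) d (U : set 'rV[R]_d.+1) p :
  convex_domain U -> bdry U p ->
  exists2 a : 'rV[R]_d.+1, dotp a a = 1 & forall x, U x -> 0 < dotp a (x - p).
Proof.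
move=> cU /cU[a [b [a0 [/= ap _] HU side]]].
have aa : 0 < dotp a a.
  have sq i : 0 <= a 0 i * a 0 i by rewrite -expr2 sqr_ge0.
  rewrite lt_neqAle sumr_ge0 // andbT eq_sym; apply: contra a0 => /eqP H.
  apply/eqP/rowP => i; rewrite mxE; apply/eqP; rewrite -sqrf_eq0 expr2.
  by have := psumr_eq0P (fun i _ => sq i) H => /(_ i isT) ->.
have ea : 0 < enorm a by rewrite /enorm sqrtr_gt0.
have ee : enorm a ^+ 2 = dotp a a by rewrite /enorm sqr_sqrtr// ltW.
have ne x : U x -> dotp a (x - p) != 0.
  move=> Ux; rewrite dotpBr ap subr_eq0; apply/eqP => E.
  by have : (hyperplane a b `&` U) x by []; rewrite HU.
have [s [s1 Hs]] : exists s : R, s ^+ 2 = 1 /\ forall x, U x -> 0 < s * dotp a (x - p).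
  case: side => side; [exists (-1)|exists 1]; split; rewrite ?sqrrN ?expr1n// => x Ux.
    by rewrite mulN1r oppr_gt0 lt_neqAle ne//= dotpBr ap subr_le0 side.
  by rewrite mul1r lt_neqAle eq_sym ne//= dotpBr ap subr_ge0 side.
exists ((s / enorm a) *: a) => [|x Ux].
  rewrite dotpZr dotpZl mulrA -expr2 exprMn s1 mul1r exprVn ee mulVf// gt_eqF//.
by rewrite dotpZl mulrAC divr_gt0// Hs.
Qed.

(** * Global estimates for a solution *)

Lemma solution_min_principle (R : realType) n (U : set 'rV[R]_n.-1.+1)
    (g : 'rV[R]_n.-1.+1 -> R) (eps : R) :
  (2 <= n)%N -> bounded_set U -> open U -> Ck 2 U g -> {within closure U, continuous g} ->
  0 <= eps -> (forall x, U x -> 0 < g x) -> (forall x, U x -> M_op eps g x = 0) ->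
  forall x, U x -> exists2 q, bdry U q & g q <= g x.
Proof.
move=> n2 bU oU gC gc e0 g0 Mg x Ux.
have [||q bq Hq] := @boundary_max R _ U (\- g) bU oU _ _ x Ux.
- by move=> y; apply: continuousN; exact: gc.
- move=> y Uy H; apply: (no_interior_min n2 oU gC Uy e0 (g0 _ Uy) (Mg _ Uy)) => z Uz.
  by rewrite -lerN2; exact: H.
by exists q => //; rewrite -lerN2.
Qed.

(** On the boundary [g^2 + 2 horiz c] is at most [M0^2 + 2 r^2], which is at most [(M0 + 2 r)^2]. *)
Lemma solution_upper_bound (R : realType) n (U : set 'rV[R]_n.-1.+1)
    (g : 'rV[R]_n.-1.+1 -> R) (c : 'rV[R]_n.-1.+1) (eps M0 r : R) :
  (2 <= n)%N -> bounded_set U -> open U -> Ck 2 U g -> {within closure U, continuous g} ->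
  0 <= eps -> (forall x, U x -> 0 < g x) -> (forall x, U x -> M_op eps g x = 0) ->
  (forall q, bdry U q -> 0 <= g q <= M0) -> 0 <= r ->
  (forall q, bdry U q -> horiz c q <= r ^+ 2) ->
  forall x, U x -> g x <= M0 + 2 * r.
Proof.
move=> n2 bU oU gC gc e0 g0 Mg gb r0 Hr x Ux.
have [||q bq Hq] := @boundary_max R _ U (fun y => g y ^+ 2 + 2 * horiz c y) bU oU _ _ x Ux.
- move=> y; apply: cvgD.
    exact: (@cvg_comp _ _ _ g (fun t : R => t ^+ 2) _ _ _ (gc y) (@exprn_continuous R 2 (g y))).
  by apply: cvgM; [exact: cvg_cst|exact: (continuous_subspaceT (@horiz_continuous R n c))].
- by move=> y Uy; exact: no_interior_max n2 oU gC Uy e0 (g0 _ Uy) (Mg _ Uy).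
have h0 : 0 <= horiz c x by apply: sumr_ge0 => k _; rewrite sqr_ge0.
have /andP[gq0 gqM] := gb q bq; have M00 := le_trans gq0 gqM.
have := Hr q bq; have : g q ^+ 2 <= M0 ^+ 2 by rewrite ler_pXn2r.
have Mr : 0 <= M0 * r by rewrite mulr_ge0.
have r2 := sqr_ge0 r.
move=> H1 H2; rewrite -(@ler_pXn2r _ 2) ?nnegrE ?(ltW (g0 _ Ux)) ?addr_ge0 ?mulr_ge0//.
by move: Hq => /=; lra.
Qed.

Lemma barrier_estimate (R : realType) n (U : set 'rV[R]_n.-1.+1)
    (g phi : 'rV[R]_n.-1.+1 -> R) (a p : 'rV[R]_n.-1.+1) (eps m0 M F G S k : R) :
  (2 <= n)%N -> bounded_set U -> open U -> Ck 2 U g -> Ck 2 U phi ->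
  {within closure U, continuous g} -> {within closure U, continuous phi} ->
  0 <= eps <= 1 -> 0 < m0 -> (forall x, U x -> M_op eps g x = 0) ->
  (forall q, bdry U q -> g q = phi q) ->
  (forall x, U x -> m0 <= g x <= M) -> (forall x, U x -> 0 <= phi x <= F) ->
  (forall x i, U x -> `|partial i phi x| <= G) ->
  (forall x i j, U x -> `|partial j (partial i phi) x| <= S) ->
  dotp a a = 1 -> (forall x, U x -> 0 < dotp a (x - p)) ->
  0 < k -> barrier_slope n m0 M G S < k * Num.min (m0 ^+ 2) 1 ->
  forall x, U x -> `|g x - phi x| <= expR (k * (M + F)) * dotp a (x - p).
Proof.
move=> n2 bU oU gC phiC gc phic e01 m00 Mg gphi gb phib HG HS aa a0 k0 kT x Ux.
set E := expR _; have E0 : 0 < E by exact: expR_gt0.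
(* Where the barrier is below [M + F], [1 + K l < E], hence its slope [K / (1 + K l) / k] exceeds
   1. *)
pose K := k * E; have K0 : 0 < K by rewrite mulr_gt0.
pose l y := dotp a y - dotp a p.
have lE y : dotp a (y - p) = l y by rewrite dotpBr.
have lpos y : U y -> 0 < l y by rewrite -lE; exact: a0.
have lc : continuous l.
  move=> y; apply: (@continuousB _ _ _ (dotp a) (cst (dotp a p))).
    exact: dotp_continuous.
  exact: cst_continuous.
have lge y : closure U y -> 0 <= l y.
  by apply: closure_ge (continuous_subspaceT lc) _ y => z /lpos/ltW.
have arg_pos s : 0 <= s -> 0 < 1 + K * s by move=> s0; rewrite ltr_pwDl// mulr_ge0 ?(ltW K0).
have bc : {within closure U, continuous (log_barrier K k \o l)}.
  apply: continuous_in_subspaceT => y /set_mem /lge ly.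
  apply: (@continuous_comp _ _ _ l (log_barrier K k)); first exact: lc.
  exact: is_derive_continuous (is_derive_log_barrier k (arg_pos _ ly)).
have b_ge0 s : 0 <= s -> 0 <= log_barrier K k s.
  by move=> s0; rewrite divr_ge0 ?(ltW k0)// ln_ge0// lerDl mulr_ge0// (ltW K0).
have key (sg : R) : sg ^+ 2 = 1 -> forall y, U y -> sg * (g y - phi y) <= log_barrier K k (l y).
  move=> sg2 y Uy; rewrite leNgt; apply/negP => ypos.
  pose f z := sg * (g z - phi z) - log_barrier K k (l z).
  have fc : {within closure U, continuous f}.
    move=> z; apply: cvgB; last exact: bc.
    by apply: cvgM; [exact: cvg_cst|apply: cvgB; [exact: gc|exact: phic]].
  have cy : closure U y by exact: subset_closure.
  have [|c /set_mem cc cmax] := compact_EVT_max _ (compact_closure_bounded bU) fc.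
    by exists y.
  have fc0 : 0 < f c by apply: lt_le_trans (cmax y (mem_set cy)); rewrite subr_gt0.
  (* On the boundary [g = phi] and the barrier is non-negative, so a positive maximum of [f] is
     interior. *)
  have Uc : U c.
    apply: contrapT => Uc; have bqc : bdry U c by rewrite bdry_open.
    by move: fc0; rewrite /f gphi// subrr mulr0 sub0r oppr_gt0 ltNge b_ge0// lge.
  have lc0 := lpos _ Uc.
  apply: (no_interior_barrier_max n2 oU gC phiC Uc e01 m00 (gb _ Uc) (Mg _ Uc)
    (fun i => HG c i Uc) (fun i j => HS c i j Uc) aa sg2 K0 k0 kT lc0); last first.
    by move=> z Uz; apply: cmax; apply/mem_set; exact: subset_closure.
  have sgn : `|sg| = 1.
    by apply/eqP; rewrite -(@eqrXn2 _ 2)// expr1n real_normK ?num_real// sg2.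
  have : log_barrier K k (l c) < M + F.
    move: fc0; rewrite /f subr_gt0 => /lt_le_trans; apply.
    apply: le_trans (ler_norm _) _; rewrite normrM sgn mul1r.
    have /andP[g1 g2] := gb _ Uc; have /andP[p1 p2] := phib _ Uc.
    by rewrite ler_norml; apply/andP; split; lra.
  have ap := arg_pos _ (ltW lc0).
  rewrite /log_barrier ltr_pdivrMr// => H.
  have {}H : 1 + K * l c < E.
    by rewrite -[ltLHS]lnK ?posrE// /E ltr_expR [ltRHS]mulrC.
  by rewrite ler_pdivlMr// mul1r ler_pdivlMr// /K ler_pM2l// ltW.
(* [ln (1 + s) <= s] replaces the barrier by its tangent at 0, of slope [K / k = E]. *)
have lnle y : U y -> log_barrier K k (l y) <= E * l y.
  move=> Uy; rewrite /log_barrier ler_pdivrMr//.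
  have -> : E * l y * k = K * l y by rewrite /K; ring.
  apply: le_ln1Dx; apply: lt_le_trans (_ : 0 <= _); first by rewrite oppr_lt0.
  by rewrite mulr_ge0 ?(ltW K0) ?(ltW (lpos _ Uy)).
rewrite lE; apply: le_trans (lnle _ Ux); rewrite ler_norml.
have := key 1 (expr1n _ _) _ Ux; have := key (-1) ltac:(by rewrite sqrrN expr1n) _ Ux.
by rewrite mulN1r mul1r => H1 H2; apply/andP; split; lra.
Qed.

(** * Suprema of the data and the final constant *)

Lemma entry_le_enorm (R : realType) d (u : 'rV[R]_d) i : `|u 0 i| <= enorm u.
Proof.
rewrite /enorm -sqrtr_sqr ler_wsqrtr// /dotp (bigD1 i)//= expr2 lerDl.
by apply: sumr_ge0 => j _; rewrite -expr2 sqr_ge0.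
Qed.

Lemma enorm_le_entries (R : realType) d (u : 'rV[R]_d) (B : R) :
  0 <= B -> (forall i, `|u 0 i| <= B) -> enorm u <= d%:R * B.
Proof.
move=> B0 H; rewrite enorm_le ?mulr_ge0//; apply: (@le_trans _ _ (\sum_(i < d) B ^+ 2)).
  apply: ler_sum => i _; rewrite -expr2 -(real_normK (num_real (u 0 i))).
  by rewrite ler_pXn2r ?nnegrE.
rewrite sumr_const card_ord -[leLHS]mulr_natl exprMn ler_wpM2r ?sqr_ge0//.
by rewrite -natrX ler_nat; case: (d) => // m; rewrite expnS expn1 leq_pmulr.
Qed.

Lemma entry_le_hess_norm (R : realType) d (f : 'rV[R]_d.+1 -> R) x i j :
  `|partial j (partial i f) x| <= hess_norm f x.
Proof.
suff E (H : 'I_d.+1 -> 'I_d.+1 -> R) : `|H i j| <= Num.sqrt (\sum_k \sum_l H k l ^+ 2).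
  exact: (E (fun k l => partial l (partial k f) x)).
rewrite -sqrtr_sqr ler_wsqrtr// (bigD1 i)//= (bigD1 j)//= -addrA lerDl.
rewrite addr_ge0// sumr_ge0// => k _; rewrite ?sqr_ge0//.
by apply: sumr_ge0 => l _; rewrite sqr_ge0.
Qed.

Lemma uniform_bound (R : realType) (T : Type) (I : finType) (U : set T) (f : I -> T -> R) :
  (forall i, exists B, forall x, U x -> `|f i x| <= B) ->
  exists2 B, 0 <= B & forall i x, U x -> `|f i x| <= B.
Proof.
move=> /choice[b Hb]; exists (\sum_i `|b i|); first exact: sumr_ge0.
move=> i x Ux; apply: le_trans (Hb i x Ux) _; apply: le_trans (ler_norm _) _.
by rewrite (bigD1 i)//= lerDl sumr_ge0.
Qed.

Lemma le_sup_image (R : realType) (T : Type) (U : set T) (f : T -> R) (B : R) x :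
  (forall y, U y -> f y <= B) -> U x -> f x <= sup (f @` U).
Proof.
move=> H Ux; apply: ub_le_sup; last by exists x.
by exists B => _ [y Uy <-]; exact: H.
Qed.

(** A [sup] bounds the values only if the image is bounded above; the continuous extensions to the
    compact closure ensure this. *)
Lemma le_sup_grad (R : realType) d (U : set 'rV[R]_d.+1) (f : 'rV[R]_d.+1 -> R) x i :
  bounded_set U -> (forall k, has_cont_ext U (partial k f)) -> U x ->
  `|partial i f x| <= sup ((fun y => enorm (grad f y)) @` U).
Proof.
move=> bU Hf Ux.
have [B B0 HB] := uniform_bound (fun k => cont_ext_bounded bU (Hf k)).
apply: (@le_trans _ _ (enorm (grad f x))).
  by have := entry_le_enorm (grad f x) i; rewrite mxE.
apply: (le_sup_image (f := fun y => enorm (grad f y)) (B := d.+1%:R * B)) Ux => y Uy.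
by apply: enorm_le_entries => // k; rewrite mxE HB.
Qed.

Lemma le_sup_hess (R : realType) d (U : set 'rV[R]_d.+1) (f : 'rV[R]_d.+1 -> R) x i j :
  bounded_set U -> (forall k l, has_cont_ext U (partial l (partial k f))) -> U x ->
  `|partial j (partial i f) x| <= sup (hess_norm f @` U).
Proof.
move=> bU Hf Ux.
have [B B0 HB] := uniform_bound (fun k : 'I_d.+1 * 'I_d.+1 => cont_ext_bounded bU (Hf k.1 k.2)).
apply: le_trans (entry_le_hess_norm f x i j) _.
apply: (le_sup_image (B := Num.sqrt (\sum_(i < d.+1) \sum_(j < d.+1) B ^+ 2))) Ux => y Uy.
rewrite ler_wsqrtr//; apply: ler_sum => k _; apply: ler_sum => l _.
by rewrite -(real_normK (num_real (partial _ _ _))) ler_pXn2r ?nnegrE ?(HB (k, l)).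
Qed.

Lemma barrier_slope_ge0 (R : realType) n (m0 M G S : R) :
  0 <= m0 -> 0 <= M -> 0 <= G -> 0 <= S -> 0 <= barrier_slope n m0 M G S.
Proof.
move=> m00 M0 G0 S0; rewrite /barrier_slope.
by do ![apply: sqr_ge0 | apply: addr_ge0 | apply: mulr_ge0 | rewrite invr_ge0 | by []].
Qed.

Lemma bdval_le (R : realType) d (U : set 'rV[R]_d.+1) (h : 'rV[R]_d.+1 -> R) p (c : R) :
  has_cont_ext U h -> closure U p -> (forall x, U x -> `|h x| <= c) -> `|bdval U h p| <= c.
Proof.
move=> hU cp H; apply/ler_addgt0Pr => e e0.
have [r r0 Hr] := bdval_cvg hU cp e0.
have [y [Uy]] := cp _ (nbhsx_ballx p r r0).
rewrite -ball_normE /= distrC => /(Hr y Uy) Hy.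
rewrite -[bdval _ _ _](subKr (h y)); apply: le_trans (ler_normB _ _) _.
by apply: lerD => //; exact: H.
Qed.

Theorem theorem4p1 (R : realType) (n : nat) (hn : (2 <= n)%N) :
  exists C : R -> R -> R -> R -> R -> R -> R,
  forall (Omega : set 'rV[R]_n.-1.+1) (phi g : 'rV[R]_n.-1.+1 -> R) (eps : R),
    bounded_set Omega -> C2_domain Omega -> convex_domain Omega ->
    Ck_closure 2 Omega phi -> (forall x, closure Omega x -> 0 < phi x) ->
    0 <= eps <= 1 ->
    Ck 2 Omega g -> Ck_closure 1 Omega g -> (forall x, Omega x -> 0 < g x) ->
    (forall x, Omega x -> M_op eps g x = 0) ->
    (forall p, bdry Omega p -> g p = phi p) ->
  forall p, bdry Omega p ->
    enorm (grad_closure Omega g p) <=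
      C (inf (g @` bdry Omega)) (sup (g @` bdry Omega)) (r_dom Omega)
        (sup (phi @` Omega)) (sup ((fun x => enorm (grad phi x)) @` Omega))
        (sup (hess_norm phi @` Omega)).
Proof.
(* [M] is the bound for [g] with the radius [r + 1] of [r_dom_disk]; the [+ 1] in [k] makes the
   threshold inequality strict. The factor [n.-1.+1] passes from entries to the Euclidean norm, and
   [G] pays for [D phi] in [Dg = D (g - phi) + D phi]. *)
exists (fun m0 M0 r F G S =>
  let M := M0 + 2 * (r + 1) in
  let k := (barrier_slope n m0 M G S + 1) / Num.min (m0 ^+ 2) 1 in
  n.-1.+1%:R * (expR (k * (M + F)) + G)).
move=> U phi g eps bU [[oU _ [x0 Ux0]] UC2] Ucvx [phiC phic phiext] phi0 e01 gC [gC1 gc gext]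
  g0 Mg gphi p bp.
cbv beta zeta.
set m0 := inf _; set M0 := sup _; set r := r_dom U.
set F := sup (phi @` U); set G := sup ((fun x => enorm (grad phi x)) @` U).
set S := sup (hess_norm phi @` U).
set M := M0 + _; set k := _ / _.
have [e0 e1] := andP e01.
have cp : closure U p by case: bp.
have bdc q : bdry U q -> closure U q by case.
have [Bg HBg] := within_closure_image_bounded bU gc.
have gpos q : bdry U q -> 0 < g q by move=> bq; rewrite gphi// phi0//; exact: bdc.
(* An infimum of positive numbers could vanish; here the minimum is attained on the compact
   boundary. *)
have m00 : 0 < m0.
  have [|q /set_mem bq Hq] := compact_EVT_min _ (compact_bdry bU)
    (continuous_subspaceW bdc gc); first by exists p.
  apply: lt_le_trans (gpos q bq) _; apply: lb_le_inf; first by exists (g p); exists p.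
  by move=> _ [y bz <-]; apply: Hq; exact/mem_set.
have m0g q : bdry U q -> m0 <= g q.
  move=> bq; apply: ge_inf; last by exists q.
  by exists 0 => _ [y bz <-]; exact/ltW/gpos.
have gM0 q : bdry U q -> g q <= M0.
  move=> bq; apply: (le_sup_image (B := Bg)) bq => y bz.
  by apply: le_trans (ler_norm _) (HBg y (bdc y bz)).
have [r0 [c Hc]] := @r_dom_disk R n U hn bU (ex_intro _ x0 Ux0) (ex_intro _ p bp).
have gM x : U x -> m0 <= g x <= M.
  move=> Ux; apply/andP; split.
    have [q bq] := solution_min_principle hn bU oU gC gc e0 g0 Mg Ux.
    by apply: le_trans; exact: m0g.
  apply: (solution_upper_bound hn bU oU gC gc e0 g0 Mg _ r0 Hc) Ux => q bq.
  by rewrite (ltW (gpos q bq)) gM0.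
have [Bphi HBphi] := within_closure_image_bounded bU phic.
have phiF x : U x -> 0 <= phi x <= F.
  move=> Ux; rewrite (ltW (phi0 _ (subset_closure Ux)))/=.
  apply: (le_sup_image (B := Bphi)) Ux => y Uy.
  exact: le_trans (ler_norm _) (HBphi y (subset_closure Uy)).
have phiG x i : U x -> `|partial i phi x| <= G.
  by apply: le_sup_grad => // l; case: phiext => _ /(_ l)[].
have phiS x i j : U x -> `|partial j (partial i phi) x| <= S.
  by apply: le_sup_hess => // l l'; case: phiext => _ /(_ l)[_ /(_ l')[]].
have G0 : 0 <= G := le_trans (normr_ge0 _) (phiG _ ord0 Ux0).
have S0 : 0 <= S := le_trans (normr_ge0 _) (phiS _ ord0 ord0 Ux0).
have Mpos : 0 <= M.
  by have /andP[mg gx] := gM _ Ux0; exact: le_trans (ltW m00) (le_trans mg gx).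
have c0 : 0 < Num.min (m0 ^+ 2) 1 by rewrite lt_min exprn_gt0// ltr01.
have T0 := barrier_slope_ge0 n (ltW m00) Mpos G0 S0.
have k0 : 0 < k by rewrite divr_gt0// ltr_wpDl.
have kT : barrier_slope n m0 M G S < k * Num.min (m0 ^+ 2) 1.
  by rewrite /k divfK ?gt_eqF// ltrDl.
have [a aa apos] := supporting_normal Ucvx bp.
have est := barrier_estimate hn bU oU gC phiC gc phic e01 m00 Mg gphi gM phiF
  phiG phiS aa apos k0 kT.
set E := expR _ in est *.
have E0 : 0 <= E by exact: expR_ge0.
have phi_ext i : has_cont_ext U (partial i phi) by case: phiext => _ /(_ i)[].
have g_ext i : has_cont_ext U (partial i g) by case: gext => _ /(_ i)[].
have [V [W [psi [chi [[oV oW Vp] [HVW HWV] psiC chiC HU]]]]] := UC2 p bp.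
have [Wpsi chipsi] := HVW p Vp.
(* Two things are kept of the chart: the last coordinate of [psi] as a [C^1] defining function, and
   a vector along which its derivative at [p] is 1. *)
have trans := straightening_transversal oV oW Vp Wpsi chipsi HWV (CkS (psiC ord_max))
  (fun i => CkS (chiC i)).
have W_le i : `|(grad_closure U g p - grad_closure U phi p) 0 i| <= E.
  apply: (boundary_gradient_bound (U := U) (w := fun y => g y - phi y)
    (Dw := fun y => grad g y - grad phi y) (a := a) oV Vp (CkS (psiC ord_max)) _ _ trans) => //.
  - exact: (HU p Vp).2.1.
  - by move=> x Vx; exact: (HU x Vx).1.2.
  - move=> x u Ux; rewrite dotpBl; apply: is_deriveB.
      exact: C1_is_derive oU (CkS gC) Ux.
    exact: C1_is_derive oU (CkS phiC) Ux.
  - move=> e ee; have e2 : 0 < e / 2 by rewrite divr_gt0.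
    have [q q0 Hq] : exists2 q : R, 0 < q & forall y, `|y - p| < q -> forall j, U y ->
        `|(grad g y - grad phi y) 0 j - (grad_closure U g p - grad_closure U phi p) 0 j| <= e.
      apply: near_all => j.
      have [q q0 Hq] := bdval_cvg (g_ext j) cp e2.
      have [s s0 Hs] := bdval_cvg (phi_ext j) cp e2.
      apply/nbhs_ballP; exists (Num.min q s); first by rewrite /= lt_min q0.
      move=> y; rewrite -ball_normE /= distrC lt_min => /andP[yq ys] Uy.
      rewrite !mxE; have := Hq y Uy yq; have := Hs y Uy ys.
      rewrite !ler_norml => /andP[? ?] /andP[? ?]; apply/andP; split; lra.
    by exists q => // x Ux xq j; exact: Hq.
  - by move=> j; rewrite -[1]sqrtr1 -aa; exact: entry_le_enorm.
rewrite -/E; apply: enorm_le_entries => [|i]; first by rewrite addr_ge0.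
rewrite -[grad_closure U g p](subrK (grad_closure U phi p)) mxE.
apply: le_trans (ler_normD _ _) (lerD (W_le i) _).
by rewrite mxE; apply: bdval_le => // x Ux; exact: phiG.
Qed.
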